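(* Let $G$ be a finite simple graph. Suppose that $G$ is not a $2$-cograph but every proper induced minor of $G$ and every proper induced minor of $\overline{G}$ is a $2$-cograph. Then $5 \leq |V(G)| \leq 10$.
   Context: All graphs are finite and simple; $\overline{G}$ denotes the complement of $G$. A graph is $2$-connected if it has at least three vertices, is connected, and has no cut vertex. A graph $G$ is a $2$-cograph if $G$ has no induced subgraph $H$ such that both $H$ and $\overline{H}$ are $2$-connected (in particular $K_1$ is a $2$-cograph). For an edge $e$ of $G$, $G/e$ denotes the simple graph obtained by contracting $e$ and then deleting all but one edge from each class of parallel edges. An induced minor of $G$ is a graph obtained from $G$ by a sequence of vertex deletions and edge contractions; it is proper if it is not $G$ itself (i.e. at least one deletion or contraction is performed). *)

(* Defs.v *)
From Stdlib Require Export Relation_Operators.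
From mathcomp Require Export all_boot.

Set Implicit Arguments.
Unset Strict Implicit.
Unset Printing Implicit Defensive.

Record sgraph := SGraph {
  vertex :> finType;
  adj : rel vertex;
  adj_sym : symmetric adj;
  adj_irr : irreflexive adj
}.

Section Constructions.
Variable G : sgraph.

Definition compl_adj : rel G := [rel x y | (x != y) && ~~ adj x y].

Fact compl_sym : symmetric compl_adj.
Proof. by move=> x y; rewrite /compl_adj /= eq_sym adj_sym. Qed.

Fact compl_irr : irreflexive compl_adj.
Proof. by move=> x; rewrite /compl_adj /= eqxx. Qed.

Definition compl : sgraph := SGraph compl_sym compl_irr.

Section Induced.
Variable A : {set G}.

Definition induced_adj : rel {x : G | x \in A} :=
  [rel x y | adj (val x) (val y)].

Fact induced_sym : symmetric induced_adj.
Proof. by move=> x y; rewrite /induced_adj /= adj_sym. Qed.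

Fact induced_irr : irreflexive induced_adj.
Proof. by move=> x; rewrite /induced_adj /= adj_irr. Qed.

Definition induced : sgraph := SGraph induced_sym induced_irr.
End Induced.

Definition del_vertex (v : G) : sgraph := induced [set~ v].

(* Contraction of the edge uv: [v] is identified with [u], so the vertex set  *)
(* is V(G) - v and [u] stands for the merged vertex, whose neighbours are     *)
(* those of [u] or of [v]. Loops are discarded, and parallel edges are        *)
(* merged since adjacency is a relation.                                      *)
Section Contract.
Variables u v : G.

Definition contract_adj : rel {x : G | x \in [set~ v]} :=
  [rel x y | [&& x != y &
     [|| adj (val x) (val y),
         (val x == u) && adj v (val y)
       | (val y == u) && adj (val x) v]]].

Fact contract_sym : symmetric contract_adj.
Proof.
move=> x y; rewrite /contract_adj /= eq_sym (adj_sym (val x) (val y)).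
by congr (_ && (_ || _)); rewrite orbC !(adj_sym v).
Qed.

Fact contract_irr : irreflexive contract_adj.
Proof. by move=> x; rewrite /contract_adj /= eqxx. Qed.

Definition contract : sgraph := SGraph contract_sym contract_irr.
End Contract.

Definition ncomp : nat := n_comp (@adj G) predT.

Definition connectedg : bool :=
  (0 < #|G|) && [forall x : G, forall y : G, connect (@adj G) x y].

End Constructions.

Definition cut_vertex (G : sgraph) (v : G) : bool :=
  ncomp G < ncomp (del_vertex v).

Definition two_connected (G : sgraph) : bool :=
  [&& 3 <= #|G|, connectedg G & [forall v : G, ~~ cut_vertex v]].

Definition two_cograph (G : sgraph) : bool :=
  ~~ [exists A : {set G},
        two_connected (induced A) && two_connected (compl (induced A))].

Variant minor_step (G : sgraph) : sgraph -> Prop :=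
| StepDelete (v : G) : minor_step G (del_vertex v)
| StepContract (u v : G) : adj u v -> minor_step G (contract u v).

(* [proper_induced_minor G H]: H arises from G by one or more steps. Vertex   *)
(* types fix a representative of the isomorphism class of each minor, which   *)
(* is immaterial for isomorphism-invariant properties such as [two_cograph].  *)
Definition proper_induced_minor : sgraph -> sgraph -> Prop :=
  clos_trans sgraph minor_step.

(* Main.v *)
Require Import Defs.
From mathcomp Require Import all_boot zify.

Set Implicit Arguments.
Unset Strict Implicit.
Unset Printing Implicit Defensive.

(** A minimal non-2-cograph G is 2-connected and so is its complement H. By
    minimality every vertex lies in a 2-cut of G or of H, and every edge [ab] of
    G (likewise of H) either is a 2-cut of G or destroys the 2-connectivity of
    the complement when contracted. Suppose G has more than 10 vertices.

    If some 2-cut [{u, v}] of G has both sides X, Y of size at least 2, then H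
    contains the complete bipartite graph between X and Y, so it survives almost
    every deletion or contraction inside X. Hence the vertices of X are cut
    vertices of G minus a point; the fragments they cut off are forced into the
    few non-neighbours of [u] or [v], and counting the fragments bounds X.

    Otherwise every 2-cut of G and of H isolates a single vertex, so the
    neighbours of the degree-2 vertices of G and of H cover everything. Double
    counting between the two sets S, D of degree-2 vertices contradicts this if
    both have at least two elements; if S has at most one element, contracting
    an edge of H at a vertex of D exhibits a bridge of G minus two vertices, one
    of whose sides is tiny. *)

(** * Separations by two vertices *)

Section Separations.
Variable T : finType.
Implicit Types (e h c : rel T) (K L : {set T}) (a b u v x y z : T).

(** 2-connectivity through cuts instead of paths: no vertex [z] separates a set [K] from the rest.
    With at least three vertices this includes connectivity. *)
Definition biconn e := forall K z,
  z \notin K -> (exists x, x \in K) -> (exists2 w, w \notin K & w != z) ->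
  exists x y, [/\ x \in K, y \notin K, y != z & e x y].

(** The sides are unions of components of the graph without [a] and [b], not necessarily single
    components. *)
Record sep e K L a b : Prop := Sep {
  sep_neq : a != b;
  sep_l : exists x, x \in K;
  sep_r : exists x, x \in L;
  sep_part : forall x, (x \in L) = [&& x \notin K, x != a & x != b];
  sep_aK : a \notin K;
  sep_bK : b \notin K;
  sep_edge : forall x y, x \in K -> y \in L -> e x y = false }.

(** For a 2-connected [e]: deleting [v] destroys 2-connectivity, with [z] as the resulting cut
    vertex. *)
Definition critv e v := exists K L z, sep e K L v z.

(* If [h] is the complement of [e], then off [b] this is the complement of the
   contraction that merges [b] into [a]: the merged vertex keeps only the common
   [h]-neighbours. The vertex [b] stays in the type, so that "the contracted
   graph is not 2-connected" reads [critv (ctr h a b) b]. *)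
Definition ctr h a b : rel T :=
  [rel x y | [&& h x y, (x == a) ==> h b y & (y == a) ==> h x b]].

(** All that is retained of a minimal graph and its complement. In [tight_ctr] the first alternative
    makes the vertex merged from [a] and [b] a cut vertex of the contraction; in the second the
    complement of the contraction fails. *)
Record tight e h : Prop := Tight {
  tight_sym : symmetric e;
  tight_irr : irreflexive e;
  tight_cpl : forall x y, h x y = (x != y) && ~~ e x y;
  tight_biconn : biconn e;
  tight_cobiconn : biconn h;
  tight_crit : forall v, critv e v \/ critv h v;
  tight_ctr : forall a b, e a b ->
    (exists K L, sep e K L a b) \/ critv (ctr h a b) b;
  tight_coctr : forall a b, h a b ->
    (exists K L, sep h K L a b) \/ critv (ctr e a b) b }.

Lemma cpl_sym e h : symmetric e ->
  (forall x y, h x y = (x != y) && ~~ e x y) -> symmetric h.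
Proof. by move=> es hE x y; rewrite !hE eq_sym es. Qed.

Lemma tightC e h : tight e h -> tight h e.
Proof.
case=> es ei hE be bh cr ce ch; split=> //.
- exact: cpl_sym es hE.
- by move=> x; rewrite hE eqxx.
- move=> x y; rewrite hE negb_and !negbK.
  by case: eqP => [->|]; rewrite ?ei.
- by move=> v; case: (cr v); [right|left].
Qed.

Lemma ctr_sym h a b : symmetric h -> symmetric (ctr h a b).
Proof.
move=> hs x y; rewrite /ctr /= (hs x y) (hs x b) (hs b y).
by case: (h y x) => //=; rewrite andbC.
Qed.

Lemma biconn_closed e K z : biconn e -> z \notin K -> (exists x, x \in K) ->
  (exists2 w, w \notin K & w != z) ->
  ~ (forall x y, x \in K -> e x y -> y != z -> y \in K).
Proof.
by move=> be zK K0 w0 cl; have [x [y [xK /negP yK yz exy]]] := be _ _ zK K0 w0;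
  apply: yK; apply: cl exy yz.
Qed.

Section Sep.
Variables (e : rel T) (es : symmetric e).

Lemma sep_swap K L a b : sep e K L a b -> sep e K L b a.
Proof.
case=> ab K0 L0 LE aK bK ed; split=> //; first by rewrite eq_sym.
by move=> x; rewrite LE [(x != a) && _]andbC.
Qed.

Lemma sepC K L a b : sep e K L a b -> sep e L K a b.
Proof.
case=> ab K0 L0 LE aK bK ed; split=> //.
- move=> x; rewrite LE; case xK: (x \in K) => /=; last first.
    by case: eqP => //= _; case: eqP.
  by rewrite (memPn aK) ?(memPn bK).
- by rewrite LE eqxx /= andbF.
- by rewrite LE eqxx /= !andbF.
- by move=> x y xL yK; rewrite es ed.
Qed.

Lemma sepP K L a b x : sep e K L a b ->
  [\/ x = a, x = b, x \in K | x \in L].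
Proof.
move=> s; have := sep_part s x.
case: (x =P a) => [->|_]; first by constructor 1.
case: (x =P b) => [->|_]; first by constructor 2.
by case: (x \in K) => /= xL; [constructor 3|constructor 4].
Qed.

Lemma sep_disj K L a b x : sep e K L a b -> x \in K -> x \in L -> False.
Proof. by move=> s xK; rewrite (sep_part s) xK. Qed.

Lemma sep_neqa K L a b x : sep e K L a b -> x \in K -> x != a.
Proof. by move=> s xK; apply: contraTneq xK => ->; exact: sep_aK s. Qed.

Lemma sep_neqb K L a b x : sep e K L a b -> x \in K -> x != b.
Proof. by move=> s xK; apply: contraTneq xK => ->; exact: sep_bK s. Qed.

Lemma sep_nb K L a b x y : sep e K L a b -> x \in K -> e x y ->
  [\/ y = a, y = b | y \in K].
Proof.
move=> s xK exy; case: (sepP y s); try by constructor.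
by move=> yL; rewrite (sep_edge s) in exy.
Qed.

(** If [a] had no neighbour in [K], then [b] alone would separate [K] from the rest. *)
Lemma sep_nbr K L a b : biconn e -> sep e K L a b ->
  exists2 x, x \in K & e a x.
Proof.
move=> be s.
have [|x [y [xK yK yb exy]]] := be K b (sep_bK s) (sep_l s).
  exists a; [exact: sep_aK s|exact: sep_neq s].
exists x => //; rewrite es.
by case: (sep_nb s xK exy) => [<-||] // yE; [rewrite yE eqxx in yb|rewrite yE in yK].
Qed.

Lemma sep_nbr2 K L a b : biconn e -> sep e K L a b ->
  exists2 x, x \in K & e b x.
Proof. by move=> be /sep_swap; exact: sep_nbr. Qed.

End Sep.

(* The complete bipartite graph between [X :\ b] and [Y] stays connected after
   deleting any [z], so only [u] and [v] could be cut off. *)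
Lemma core_biconn c (X Y : {set T}) u v b K L z :
  symmetric c ->
  (forall x, [|| x \in X, x \in Y, x == u | x == v]) ->
  b \in X -> 2 < #|X| -> 1 < #|Y| -> [disjoint X & Y] ->
  (forall x y, x \in X -> x != b -> y \in Y -> c x y) ->
  (forall z, exists x, [/\ x != z, x != b, x != u & c u x]) ->
  (forall z, exists x, [/\ x != z, x != b, x != v & c v x]) ->
  (forall z, exists x, [/\ x != z, x != b, x \in X :|: Y & c u x || c v x]) ->
  ~ sep c K L b z.
Proof.
move=> cs cov bX X3 Y2 dXY cXY Hu Hv Huv.
have [y0 y0Y y0z] : exists2 y, y \in Y & y != z.
  have /card_gt0P[y] : 0 < #|Y :\ z| by have := cardsD1 z Y; lia.
  by rewrite !inE => /andP[yz yY]; exists y.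
have [x0 x0X /andP[x0z x0b]] : exists2 x, x \in X & (x != z) && (x != b).
  have /card_gt0P[x] : 0 < #|X :\ b :\ z|.
    by have := cardsD1 z (X :\ b); have := cardsD1 b X; rewrite bX; lia.
  by rewrite !inE => /and3P[xz xb xX]; exists x => //; rewrite xz xb.
have YneqX x y : x \in X -> y \in Y -> y != x.
  by move=> xX yY; apply: contraTneq yY => ->; rewrite (disjointFr dXY).
have XYb y : y \in Y -> y != b by exact: YneqX.
(* By symmetry [K'] is the side of [y0]; it swallows [X :|: Y] apart from [b] and [z], leaving only
   [u] and [v] for [L']. *)
suff aux K' L' : y0 \in K' -> ~ sep c K' L' b z.
  move=> s; case: (sepP y0 s) => y0E; last 2 first.
  - exact: aux s.
  - by apply: (aux L K) => //; apply: sepC.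
  - by move: (XYb _ y0Y); rewrite y0E eqxx.
  - by move: y0z; rewrite y0E eqxx.
move=> y0K s.
have XK x : x \in X -> x != b -> x != z -> x \in K'.
  move=> xX xb xz; have := cXY _ _ xX xb y0Y; rewrite cs => cyx.
  by case: (sep_nb s y0K cyx) => // E; [rewrite E eqxx in xb|rewrite E eqxx in xz].
have YK y : y \in Y -> y != z -> y \in K'.
  move=> yY yz; have cxy := cXY _ _ x0X x0b yY.
  case: (sep_nb s (XK _ x0X x0b x0z) cxy) => // E; last by rewrite E eqxx in yz.
  by move: (XYb _ yY); rewrite E eqxx.
have WK x : x \in X :|: Y -> x != b -> x != z -> x \in K'.
  by rewrite inE => /orP[xX|xY] xb xz; [apply: XK|apply: YK].
have Luv l : l \in L' -> l = u \/ l = v.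
  move=> lL; have [lb lz] : l != b /\ l != z.
    by split; [apply: sep_neqa (sepC cs s) lL|apply: sep_neqb (sepC cs s) lL].
  case/or4P: (cov l) => [lX|lY|/eqP|/eqP]; [| |by left|by right].
    by case: (sep_disj s (XK _ lX lb lz) lL).
  by case: (sep_disj s (YK _ lY lz) lL).
have nbL x y : x \in L' -> c x y -> y != b -> y != z -> y \in L'.
  move=> xL cxy yb yz.
  by case: (sep_nb (sepC cs s) xL cxy) => // E; [rewrite E eqxx in yb|rewrite E eqxx in yz].
have [x [xz xb xXY /orP cx]] := Huv z.
have xK := WK _ xXY xb xz.
have [l lL] := sep_r s.
(* One of [u] and [v] is adjacent to a vertex of [K'], so they do not share [L']. Nor can one be
   there alone: its neighbour off [b] and [z] falls into [L'] too and must be the other one. *)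
have noboth : u \in L' -> v \in L' -> False.
  move=> uL vL; case: cx => /nbL xL; apply: (sep_disj s xK); exact: xL.
case: (Luv _ lL) => lE; rewrite lE in lL.
  have [w [wz wb wu cw]] := Hu z; have wL := nbL _ _ lL cw wb wz.
  by case: (Luv _ wL) => wE; [rewrite wE eqxx in wu|apply: noboth; rewrite -?wE].
have [w [wz wb wu cw]] := Hv z; have wL := nbL _ _ lL cw wb wz.
by case: (Luv _ wL) => wE; [apply: noboth; rewrite -?wE|rewrite wE eqxx in wu].
Qed.

End Separations.

(** * Contradictions and counting *)

Ltac clash := solve [ done
  | match goal with
    | H : is_true (?x != ?y), E : ?x = ?y |- _ => by rewrite E eqxx in H
    | H : is_true (?x != ?y), E : ?y = ?x |- _ => by rewrite E eqxx in H
    | H : is_true (?x \notin ?K), H' : is_true (?x \in ?K) |- _ =>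
        by rewrite H' in H
    | H : is_true (?x \notin ?K), H' : is_true (?y \in ?K), E : ?x = ?y |- _ =>
        by rewrite E H' in H
    | H : is_true (?x \notin ?K), H' : is_true (?y \in ?K), E : ?y = ?x |- _ =>
        by rewrite -E H' in H
    end ].

(** A weighted pigeonhole bound. Below, [phi] mostly sends a cut vertex to a neighbour in the
    fragment it cuts off, and the weight limits how many vertices share that image. *)
Lemma card_fiber_le (T : finType) (A X : {set T}) (phi : T -> T) (w : T -> nat) :
  (forall a, a \in A -> phi a \in X) ->
  (forall f, f \in X -> #|[set a in A | phi a == f]| <= w f) ->
  #|A| <= \sum_(f in X) w f.
Proof.
move=> AX fib; rewrite -sum1_card (partition_big phi (mem X)) //=.
apply: leq_sum => f fX; apply: leq_trans (fib f fX).
by rewrite -sum1_card leq_eqVlt; apply/orP; left; apply/eqP/eq_bigl => a; rewrite !inE.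
Qed.

Lemma card_pick2 (T : finType) (A : {set T}) a b : 2 < #|A| ->
  exists2 x, x \in A & (x != a) && (x != b).
Proof.
move=> A3; have /card_gt0P[x] : 0 < #|A :\ b :\ a|.
  by have := cardsD1 b A; have := cardsD1 a (A :\ b); lia.
by rewrite !inE => /and3P[xa xb xA]; exists x => //; rewrite xa xb.
Qed.

Lemma sum_bool_card (T : finType) (X : {set T}) (P : pred T) :
  \sum_(f in X) P f = #|[set x in X | P x]|.
Proof.
rewrite -sum1_card [RHS](eq_bigl (fun x => (x \in X) && P x)) => [|x]; last by rewrite inE.
by rewrite big_mkcondr; apply: eq_bigr => x _; case: (P x).
Qed.

Lemma card_pickT (T : finType) (a b : T) : 2 < #|T| ->
  exists x, (x != a) && (x != b).
Proof. by rewrite -cardsT => T3; have [x _ H] := card_pick2 a b T3; exists x. Qed.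

(** * 2-cuts with two large sides *)

Section WideCut.
Variables (T : finType) (e h : rel T).
Hypothesis tg : tight e h.
Let es := tight_sym tg.
Let hE := tight_cpl tg.
Let hs := cpl_sym es hE.
Let be := tight_biconn tg.
Let bh := tight_cobiconn tg.

Lemma cpl_of x y : x != y -> ~~ e x y -> h x y.
Proof. by move=> xy ne; rewrite hE xy ne. Qed.

Lemma adj_of x y : x != y -> ~~ h x y -> e x y.
Proof. by move=> xy; rewrite hE xy negbK. Qed.

Lemma sep_cross X Y u v x y :
  sep e X Y u v -> x \in X -> y \in Y -> (x != y) * h x y.
Proof.
move=> s xX yY; have xy : x != y.
  by apply: contraTneq yY => <-; apply/negP => /(sep_disj s xX).
by rewrite hE xy (sep_edge s xX yY).
Qed.

Lemma sep_cover X Y u v x : sep e X Y u v ->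
  [|| x \in X, x \in Y, x == u | x == v].
Proof. by move=> s; case: (sepP x s) => [->|->|->|->]; rewrite ?eqxx ?orbT. Qed.

Lemma sep_disjoint X Y u v : sep e X Y u v -> [disjoint X & Y].
Proof.
move=> s; rewrite -setI_eq0; apply/eqP/setP => x; rewrite !inE.
by apply/negP => /andP[/(sep_disj s)].
Qed.

(** The three conditions keep [u] and [v] attached in [h] once [a] and any [z] are removed, so
    [core_biconn] rules out criticality in [h]. *)
Lemma side_crit X Y u v a : sep e X Y u v -> 2 < #|X| -> 1 < #|Y| -> a \in X ->
  (forall z, exists x, [/\ x != z, x != a, x != u & h u x]) ->
  (forall z, exists x, [/\ x != z, x != a, x != v & h v x]) ->
  (forall z, exists x, [/\ x != z, x != a, x \in X :|: Y & h u x || h v x]) ->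
  critv e a.
Proof.
move=> s X3 Y2 aX Hu Hv Huv; case: (tight_crit tg a) => // -[K [L [z s']]].
case: (core_biconn hs (fun x => sep_cover x s) aX X3 Y2 (sep_disjoint s) _ Hu Hv Huv s').
by move=> x y xX _ yY; rewrite (sep_cross s xX yY).
Qed.

(** The contraction analogue: both [a] and [b] are complete to [Y] in [h], hence so is the merged
    vertex, and [core_biconn] applies to [ctr h a b]. *)
Lemma side_cut X Y u v a b : sep e X Y u v -> 2 < #|X| -> 1 < #|Y| ->
  a \in X -> b \in X -> e a b ->
  (forall z, exists x, [/\ x != z, x != b, x != u & ctr h a b u x]) ->
  (forall z, exists x, [/\ x != z, x != b, x != v & ctr h a b v x]) ->
  (forall z, exists x, [/\ x != z, x != b, x \in X :|: Y
                         & ctr h a b u x || ctr h a b v x]) ->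
  exists K L, sep e K L a b.
Proof.
move=> s X3 Y2 aX bX eab Hu Hv Huv; case: (tight_ctr tg eab) => // -[K [L [z s']]].
case: (core_biconn (ctr_sym a b hs) (fun x => sep_cover x s) bX X3 Y2 (sep_disjoint s) _ Hu Hv Huv s').
move=> x y xX xb yY; rewrite /ctr /= (sep_cross s xX yY) (sep_cross s bX yY) implybT.
by rewrite eq_sym (negbTE (sep_cross s aX yY).1).
Qed.

(** If [b] is an [h]-neighbour of [w], an edge from [w] to [a] survives the merge and avoiding [z]
    and [b] suffices; otherwise one avoids [z] and [a]. Three neighbours allow for either case. *)
Lemma nbr_ctr (D : {set T}) w a b z : 2 < #|[set x in D | h w x]| -> w != a ->
  exists x, [/\ x \in D, x != z, x != b, h w x & ctr h a b w x].
Proof.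
move=> D3 wa; case hwb: (h w b).
  have [x] := card_pick2 z b D3; rewrite inE => /andP[xD hwx] /andP[xz xb].
  by exists x; split=> //; rewrite /ctr /= hwx hwb (negbTE wa) implybT.
have [x] := card_pick2 z a D3; rewrite inE => /andP[xD hwx] /andP[xz xa].
exists x; split=> //; first by apply: contraFneq hwb => <-.
by rewrite /ctr /= hwx (negbTE wa) (negbTE xa).
Qed.

Lemma cpl_neq x y : h x y -> y != x.
Proof. by rewrite hE eq_sym => /andP[]. Qed.

Lemma biconn_deg2 (c : rel T) w z : biconn c -> 2 < #|T| ->
  exists x, [/\ x != z, x != w & c w x].
Proof.
move=> bc T3; wlog wz : z / w != z => [hyp|].
  case: (eqVneq w z) => [<-|]; last exact: hyp.
  have [x /andP[xw _]] := card_pickT w w T3.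
  by rewrite eq_sym in xw; have [y [_ yw cwy]] := hyp _ xw; exists y.
have [|||x [y [/set1P-> yw yz cwy]]] := bc [set w] z.
- by rewrite inE eq_sym.
- by exists w; rewrite inE.
- have [x /andP[xw xz]] := card_pickT w z T3.
  by exists x => //; rewrite inE.
by rewrite inE in yw; exists y.
Qed.

Lemma card_sep X Y u v : sep e X Y u v -> #|T| = (#|X| + #|Y|).+2.
Proof.
move=> s; have := sep_disjoint s; rewrite -cardsT -setI_eq0 => /eqP XY.
have := cardsUI X Y; rewrite XY cards0 addn0 => <-.
rewrite (cardsD1 u) (cardsD1 v (setT :\ u)) !inE eq_sym (sep_neq s) /=.
rewrite !add1n; congr _.+2; apply: eq_card => x; rewrite !inE andbT (sep_part s).
case xX: (x \in X) => /=; first by rewrite (sep_neqa s xX) (sep_neqb s xX).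
by rewrite andbC.
Qed.

(** * Wide cuts: few [h]-neighbours of [u] and [v] on the sides *)

Lemma narrow_crit X Y u v a :
  sep e X Y u v -> 2 < #|X| -> 1 < #|Y| -> a \in X -> ~~ h u a -> ~~ h v a ->
  critv e a.
Proof.
move=> s X3 Y2 aX hua hva.
have T3 : 2 < #|T| by rewrite (card_sep s); lia.
(* Removing [a] costs [u] and [v] no [h]-neighbour, so the 2-connectivity of [h] supplies what
   [side_crit] asks for. *)
have nbr w z : ~~ h w a -> exists x, [/\ x != z, x != a, x != w & h w x].
  move=> nwa; have [x [xz xw hwx]] := biconn_deg2 w z bh T3.
  by exists x; split=> //; apply: contraNneq nwa => <-.
apply: (side_crit s X3 Y2 aX) => z; [exact: nbr | exact: nbr |].
have inXY x : x != u -> x != v -> x \in X :|: Y.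
  by move=> xu xv; move: (sep_cover x s); rewrite inE (negbTE xu) (negbTE xv) !orbF.
case: (eqVneq z u) => [->|zu].
  by have [x [xu xa xv hvx]] := nbr v u hva; exists x; rewrite inXY // hvx orbT.
case: (eqVneq z v) => [->|zv].
  by have [x [xu xa xv hvx]] := nbr u v hua; exists x; rewrite inXY // hvx.
have [|||x [y [xuv yuv yz hxy]]] := @bh [set u; v] z.
- by rewrite !inE negb_or zu.
- by exists u; rewrite !inE eqxx.
- have [x xX /andP[xa xz]] := card_pick2 a z X3.
  by exists x => //; rewrite !inE (negbTE (sep_neqa s xX)) (negbTE (sep_neqb s xX)).
move: yuv; rewrite !inE negb_or => /andP[yu yv]; exists y; split=> //.
- by case/set2P: xuv hxy => -> hy; [apply: contraNneq hua|apply: contraNneq hva]; move=> <-.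
- exact: inXY.
- by case/set2P: xuv hxy => -> ->; rewrite ?orbT.
Qed.

(* A common neighbour of [u] and [v] outside the cut [{a, b}] keeps [u] and [v]
   on the same side, and the other side is the fragment. *)
Lemma narrow_frag X Y u v a :
  sep e X Y u v -> 2 < #|X| -> 1 < #|Y| -> a \in X -> ~~ h u a -> ~~ h v a ->
  (forall b, exists z, [/\ e u z, e v z, z != a & z != b]) ->
  exists (K : {set T}) b, [/\ {subset K <= X}, exists2 f, f \in K & e f a, a \notin K,
    forall x y, x \in K -> e x y -> [\/ y = a, y = b | y \in K]
    & (b != u -> forall x, x \in K -> h u x) /\
      (b != v -> forall x, x \in K -> h v x)].
Proof.
move=> s X3 Y2 aX hua hva Hz.
have au : a != u := sep_neqa s aX.
have av : a != v := sep_neqb s aX.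
have [K [L [b sab]]] := narrow_crit s X3 Y2 aX hua hva.
have aux K' L' : sep e K' L' a b -> u \notin K' -> v \notin K' ->
    exists (K : {set T}) b, [/\ {subset K <= X}, exists2 f, f \in K & e f a, a \notin K,
    forall x y, x \in K -> e x y -> [\/ y = a, y = b | y \in K]
    & (b != u -> forall x, x \in K -> h u x) /\
      (b != v -> forall x, x \in K -> h v x)].
  move=> s' uK vK; exists K', b.
  have KX x : x \in K' -> x \in X.
    move=> xK; case: (sepP x s) => // [E|E|xY]; try clash.
    (* [K' :&: Y] is not adjacent to [a], which lies in [X], and [u], [v] are outside [K']; if
       nonempty it would be cut off by [b] alone. *)
    case: (@biconn_closed _ e (K' :&: Y) b be).
    - by rewrite inE (negbTE (sep_bK s')).
    - by exists x; rewrite inE xK.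
    - by exists a; [rewrite inE (negbTE (sep_aK s')) | apply: sep_neq s'].
    move=> x1 y /setIP[x1K x1Y] exy yb; rewrite inE.
    have ya : y != a.
      by apply: contraTneq exy => ->; rewrite es (sep_edge s aX x1Y).
    case: (sep_nb s' x1K exy) => [|| yK]; try by move=> E; clash.
    rewrite yK; case: (sep_nb (sepC es s) x1Y exy) => // E; clash.
  split=> //; first by have [f fK eaf] := sep_nbr es be s'; exists f; rewrite // es.
  - exact: sep_aK s'.
  - by move=> x y xK exy; apply: sep_nb s' xK exy.
  split=> bw x xK; apply: cpl_of.
  - by apply: contraNneq uK => ->.
  - apply: contra uK => eux; rewrite es in eux.
    case: (sep_nb s' xK eux) => // E; clash.
  - by apply: contraNneq vK => ->.
  - apply: contra vK => eux; rewrite es in eux.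
    case: (sep_nb s' xK eux) => // E; clash.
have sC := sepC es sab.
have side w : w != a -> w != b -> exists K L, sep e K L a b /\ w \in L.
  move=> wa wb; case: (sepP w sab) => [E|E|wK|wL]; try clash.
    by exists L, K.
  by exists K, L.
have notin K' L' w : sep e K' L' a b -> w \in L' -> w \notin K'.
  by move=> s' wL; apply/negP => wK; case: (sep_disj s' wK wL).
case: (eqVneq u b) => [ub|ub].
  have [||K' [L' [s' vL]]] := side v; first by rewrite eq_sym.
    by rewrite -ub eq_sym (sep_neq s).
  by apply: (aux K' L' s'); [rewrite ub; apply: sep_bK s'|apply: notin vL].
have [||K' [L' [s' uL]]] := side u; first by rewrite eq_sym.
  exact: ub.
apply: (aux K' L' s'); first by apply: notin uL.
case: (eqVneq v b) => [->|vb]; first exact: sep_bK s'.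
have [z [euz evz za zb]] := Hz b.
case: (sep_nb (sepC es s') uL euz) => [E|E|zL]; try clash.
rewrite es in evz; case: (sep_nb (sepC es s') zL evz) => [E|E|vL]; try clash.
exact: notin vL.
Qed.

(** Each counted [a] is sent to an [e]-neighbour [f] in its fragment. The fibre of [f] lies in
    [{a, b}] and [f] is an [h]-neighbour of both [u] and [v], unless [b] is one of these; then the
    fibre is only [{a}] and [f] is still an [h]-neighbour of the other. *)
Lemma narrow_count X Y u v :
  sep e X Y u v -> 2 < #|X| -> 1 < #|Y| ->
  (forall a b, exists z, [/\ e u z, e v z, z != a & z != b]) ->
  #|[set x in X | ~~ h u x && ~~ h v x]| <=
    #|[set x in X | h u x]| + #|[set x in X | h v x]|.
Proof.
move=> s X3 Y2 Hz; set Z := [set x in X | _].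
pose Q a f := a \in Z -> [/\ f \in X, e f a & exists (K : {set T}) b,
  [/\ f \in K, forall x y, x \in K -> e x y -> [\/ y = a, y = b | y \in K]
    & (b != u -> forall x, x \in K -> h u x) /\
      (b != v -> forall x, x \in K -> h v x)]].
have [phi phiP] : exists phi, forall a, Q a (phi a).
  apply: fin_all_exists => a; case aZ: (a \in Z); last by exists a; rewrite /Q aZ.
  move: aZ; rewrite inE => /and3P[aX hua hva].
  have [K [b [KX [f fK efa] _ nbK typ]]] := narrow_frag s X3 Y2 aX hua hva (Hz a).
  by exists f => _; split=> //; [apply: KX|exists K, b].
rewrite -[X in _ <= X + _]sum_bool_card -[X in _ <= _ + X]sum_bool_card -big_split /=.
apply: (@card_fiber_le _ Z X phi (fun f => h u f + h v f)).
  by move=> a aZ; have [] := phiP a aZ.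
move=> f fX; set F := [set a in Z | _].
have [->|[a aF]] := set_0Vmem F; first by rewrite cards0.
have aZ : a \in Z by move: aF; rewrite inE => /andP[].
have [_ efa [K [b [fK nbK [typu typv]]]]] := phiP a aZ.
move: aF; rewrite inE => /andP[_ /eqP phia]; rewrite phia in efa fK.
(* A further fibre element is [b] or lies in [K]; the latter would make it an [h]-neighbour of [u]
   or [v]. *)
have FE a' : a' \in F -> a' = a \/ a' = b /\ b \in X.
  rewrite inE => /andP[aZ' /eqP phia']; have [_ efa' _] := phiP a' aZ'.
  rewrite phia' in efa'; move: aZ'; rewrite inE => /and3P[aX' hu hv].
  case: (nbK _ _ fK efa') => [|E|a'K]; [by left|by right; rewrite -E|].
  case: (eqVneq b u) => [bu|/typu hyp]; last by rewrite hyp in hu.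
  by rewrite typv // bu (sep_neq s) in hv.
case: (eqVneq b u) => [bu|bu].
  rewrite (typv _ f fK) ?bu ?(sep_neq s) // addn1.
  suff /subset_leq_card : F \subset [set a] by rewrite cards1; lia.
  apply/subsetP => a' /FE[->|[_ bX]]; first by rewrite inE.
  by have := sep_neqa s bX; rewrite bu eqxx.
rewrite (typu bu f fK); case: (eqVneq b v) => [bv|bv].
  suff /subset_leq_card : F \subset [set a] by rewrite cards1; lia.
  apply/subsetP => a' /FE[->|[_ bX]]; first by rewrite inE.
  by have := sep_neqb s bX; rewrite bv eqxx.
rewrite (typv bv f fK).
suff /subset_leq_card : F \subset [set a; b] by rewrite cards2; case: eqP; lia.
by apply/subsetP => a' /FE[->|[-> _]]; rewrite !inE eqxx ?orbT.
Qed.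

(* With [Y] this small [y] is not critical in [e], and criticality in [h] makes
   [X] a join in [e], which leaves no room for the fragments. *)
Lemma narrow_pair X Y u v y y' :
  sep e X Y u v -> 4 < #|X| -> Y = [set y; y'] -> y != y' ->
  (forall x, x \in Y -> ~~ h u x && ~~ h v x) ->
  1 < #|[set x in X | h u x]| -> 1 < #|[set x in X | h v x]| ->
  #|[set x in X | h u x && h v x]| <= 1 ->
  2 < #|[set x in X | ~~ h u x && ~~ h v x]| -> False.
Proof.
move=> s X4 YE yy' Yuv A2 B2 AB1; set Z := [set x in X | _ && ~~ _] => Z3.
have X3 : 2 < #|X| by lia.
have Y2 : 1 < #|Y| by rewrite YE cards2 yy'.
have yY : y \in Y by rewrite YE !inE eqxx.
have y'Y : y' \in Y by rewrite YE !inE eqxx orbT.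
have euv x : x \notin [set u; v] -> ~~ h u x && ~~ h v x -> e u x && e v x.
  rewrite !inE negb_or => /andP[xu xv] /andP[hu hv].
  by rewrite !adj_of // eq_sym.
have Yn x : x \in Y -> x \notin [set u; v].
  by move=> xY; rewrite !inE (negbTE (sep_neqa (sepC es s) xY)) (negbTE (sep_neqb (sepC es s) xY)).
have Xn x : x \in X -> x \notin [set u; v].
  by move=> xX; rewrite !inE (negbTE (sep_neqa s xX)) (negbTE (sep_neqb s xX)).
have /andP[euy' evy'] := euv _ (Yn _ y'Y) (Yuv _ y'Y).
have Hz a b : exists z, [/\ e u z, e v z, z != a & z != b].
  have [z] := card_pick2 a b Z3; rewrite inE => /andP[zX zuv] /andP[za zb].
  by have /andP[] := euv _ (Xn _ zX) zuv; exists z.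
(* The [e]-neighbours of [y] are among [u], [v], [y'], and no two of these can be separated: [y'] is
   adjacent to both [u] and [v], which have a common neighbour off any two vertices. *)
have ncrit : ~ critv e y.
  case=> [K [L [w s']]].
  have [k kK eyk] := sep_nbr es be s'.
  have [l lL eyl] := sep_nbr es be (sepC es s').
  have nby x : e y x -> [\/ x = u, x = v | x = y'].
    move=> eyx; case: (sep_nb (sepC es s) yY eyx) => [||xY]; try by constructor.
    move: xY; rewrite YE => /set2P[xE|]; last by constructor.
    by rewrite xE (tight_irr tg) in eyx.
  have nokl K' L' : sep e K' L' y w -> u \in K' -> v \in L' -> False.
    move=> s1 uK vL; have [z [euz evz zy zw]] := Hz y w.
    case: (sep_nb s1 uK euz) => [E|E|zK]; try clash.
    by rewrite es (sep_edge s1 zK vL) in evz.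
  have ekl := sep_edge s' kK lL.
  case: (nby _ eyk) (nby _ eyl) => kE [] lE; rewrite kE lE in kK lL ekl;
    try by [case: (sep_disj s' kK lL) | apply: nokl s' kK lL
           | apply: nokl (sepC es s') lL kK | rewrite ?euy' ?evy' in ekl
           | rewrite es ?euy' ?evy' in ekl].
have [//|[K [L [w sh]]]] := tight_crit tg y.
have hshC := sepC hs sh.
(* Otherwise the side of [y'] contains all of [X] except perhaps [w], hence also [u] and [v] through
   their two [h]-neighbours in [X], and the other side is empty. *)
have wE : w = y'.
  apply/eqP/negPn/negP => wy'.
  suff aux K' L' : sep h K' L' y w -> y' \in K' -> False.
    case: (sepP y' sh) => [E|E|/(aux _ _ sh)//|/(aux _ _ hshC)//]; try clash.
  move=> s1 y'K; have XK x : x \in X -> x != w -> x \in K'.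
    move=> xX xw; have [_] := sep_cross s xX y'Y; rewrite hs => hyx.
    case: (sep_nb s1 y'K hyx) => // E; last by clash.
    by have := sep_cross s xX yY; rewrite E eqxx; case.
  have [l lL] := sep_r s1.
  have noX x : x \in X -> x \in L' -> False.
    move=> xX xL; apply: (sep_disj s1 _ xL); apply: XK => //.
    by apply: sep_neqb (sepC hs s1) xL.
  have bad q : 1 < #|[set x in X | h q x]| -> q \in L' -> False.
    move=> q2 qL; have /card_gt0P[x] : 0 < #|[set x in X | h q x] :\ w|.
      by have := cardsD1 w [set x in X | h q x]; lia.
    rewrite !inE => /and3P[xw xX hqx].
    by have := sep_edge s1 (XK _ xX xw) qL; rewrite hs hqx.
  case: (sepP l s) => [lE|lE|lX|lY].
  - by apply: (bad u) => //; rewrite -lE.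
  - by apply: (bad v) => //; rewrite -lE.
  - exact: noX lX lL.
  move: lY; rewrite YE => /set2P[] lE; rewrite lE in lL.
    by have := sep_neqa (sepC hs s1) lL; rewrite eqxx.
  exact: sep_disj s1 y'K lL.
rewrite wE in sh hshC => {w wE}.
have meetX K' L' : sep h K' L' y y' -> exists2 x, x \in X & x \in K'.
  move=> s1; have [k kK] := sep_l s1.
  have bad q : 1 < #|[set x in X | h q x]| -> q \in K' -> exists2 x, x \in X & x \in K'.
    move=> q2 qK; have /card_gt0P[x] : 0 < #|[set x in X | h q x]| by lia.
    rewrite !inE => /andP[xX hqx]; exists x => //.
    case: (sep_nb s1 qK hqx) => // E.
      by have := sep_cross s xX yY; rewrite E eqxx; case.
    by have := sep_cross s xX y'Y; rewrite E eqxx; case.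
  case: (sepP k s) => [kE|kE|kX|kY]; try by exists k.
  - by apply: (bad u) => //; rewrite -kE.
  - by apply: (bad v) => //; rewrite -kE.
  move: kY; rewrite YE => /set2P[] kE; rewrite kE in kK.
    by have := sep_neqa s1 kK; rewrite eqxx.
  by have := sep_neqb s1 kK; rewrite eqxx.
have XKL x : x \in X -> x \in K \/ x \in L.
  move=> xX; case: (sepP x sh) => [E|E||]; [| |by left|by right].
    by have := sep_cross s xX yY; rewrite E eqxx; case.
  by have := sep_cross s xX y'Y; rewrite E eqxx; case.
have join x x' : x \in K -> x' \in L -> e x x'.
  move=> xK xL; apply: adj_of; last by rewrite (sep_edge sh).
  by apply: contraTneq xL => <-; apply/negP => /(sep_disj sh xK).
pose frag a (Ka : {set T}) b := [/\ {subset Ka <= X}, exists2 f, f \in Ka & e f a,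
    forall x, x \in Ka -> x \notin Z,
    forall x y, x \in Ka -> e x y -> [\/ y = a, y = b | y \in Ka]
    & b \in X -> forall x, x \in Ka -> h u x && h v x].
have fragP a : a \in Z -> exists (Ka : {set T}) b, frag a Ka b.
  rewrite inE => /and3P[aX hua hva].
  have [Ka [b [KX Kf _ nbK [typu typv]]]] := narrow_frag s X3 Y2 aX hua hva (Hz a).
  exists Ka, b; split=> // [x xK|bX x xK].
    rewrite inE (KX _ xK) /=; case: (eqVneq b u) => [bu|bu].
      by rewrite typv ?andbF // bu (sep_neq s).
    by rewrite typu.
  by rewrite typu ?typv // ?(sep_neqa s bX) // (sep_neqb s bX).
have ZX x : x \in Z -> x \in X by rewrite inE => /andP[].
(* A vertex of [Z] off [a] and [b] is joined in [e] to the fragment vertex on the opposite side,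
   which would put it into the fragment; but fragments avoid [Z]. *)
have not_both a Ka b f f' : frag a Ka b -> f \in Ka -> f \in K ->
    f' \in Ka -> f' \in L -> False.
  case=> KX _ KZ nbK _ fKa fK f'Ka f'L.
  have [z zZ /andP[za zb]] := card_pick2 a b Z3.
  have zKa : z \notin Ka by apply/negP => /KZ; rewrite zZ.
  case: (XKL _ (ZX _ zZ)) => [zK|zL].
    have := join _ _ zK f'L; rewrite es => /(nbK _ _ f'Ka)[] E; clash.
  by have := join _ _ fK zL => /(nbK _ _ fKa)[] E; clash.
have other a Ka b x x' : frag a Ka b -> x \in Ka -> 
    x' \in X -> (x \in K /\ x' \in L) \/ (x \in L /\ x' \in K) -> x' = a \/ x' = b.
  move=> fr xKa x'X side; case: (fr) => KX _ KZ nbK _.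
  have exx' : e x x' by case: side => -[xK xL]; [|rewrite es]; apply: join.
  case: (nbK _ _ xKa exx') => [||x'Ka]; [by left|by right|].
  by case: side => -[xK x'L]; [case: (not_both _ _ _ x x' fr)|case: (not_both _ _ _ x' x fr)].
suff aux (K' L' : {set T}) : (exists2 p, p \in X & p \in L') ->
    (forall x, x \in X -> x \in K' \/ x \in L') ->
    (forall a Ka b x x', frag a Ka b -> x \in Ka -> x' \in X -> x \in K' -> x' \in L' ->
       x' = a \/ x' = b) ->
    (forall a Ka b x x', frag a Ka b -> x \in Ka -> x' \in X -> x \in L' -> x' \in K' ->
       x' = a \/ x' = b) ->
    (exists a Ka b x, [/\ a \in Z, frag a Ka b, x \in Ka & x \in K']) -> False.
  have [a aZ _] := card_pick2 u u Z3; have [Ka [b fr]] := fragP _ aZ.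
  have [KX [f fKa _] _ _ _] := fr; case: (XKL _ (KX _ fKa)) => fKL.
    apply: (aux K L).
    - exact: meetX hshC.
    - exact: XKL.
    - by move=> a' Ka' b' x x' fr' xKa' x'X xK x'L; apply: other fr' xKa' x'X _; left.
    - by move=> a' Ka' b' x x' fr' xKa' x'X xK x'L; apply: other fr' xKa' x'X _; right.
    - by exists a, Ka, b, f.
  apply: (aux L K).
  - exact: meetX sh.
  - by move=> x /XKL[]; [right|left].
  - by move=> a' Ka' b' x x' fr' xKa' x'X xK x'L; apply: other fr' xKa' x'X _; right.
  - by move=> a' Ka' b' x x' fr' xKa' x'X xK x'L; apply: other fr' xKa' x'X _; left.
  - by exists a, Ka, b, f.
move=> [p pX pL] XK oth1 oth2 [a0 [K0 [b0 [f0 [a0Z fr0 f0K0 f0K]]]]].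
(* Fragments on both sides would force each half of [X] into the cut pair of the fragment opposite,
   so [X] would have at most four vertices. *)
have allK a Ka b f : frag a Ka b -> f \in Ka -> f \in K'.
  move=> fr fKa; have [KX _ _ _ _] := fr.
  case: (XK _ (KX _ fKa)) => // fL; exfalso.
  have /subset_leq_card : X \subset [set a0; b0; a; b].
    apply/subsetP => x xX; rewrite !inE; case: (XK _ xX) => xKL.
      by case: (oth2 _ _ _ _ _ fr fKa xX fL xKL) => ->; rewrite eqxx ?orbT.
    by case: (oth1 _ _ _ _ _ fr0 f0K0 xX f0K xKL) => ->; rewrite eqxx ?orbT.
  have : #|[set a0; b0; a; b]| <= 4.
    by rewrite -!setUA !cardsU1 cards1; do !case: (_ \notin _).
  lia.
(* Lying opposite to all fragments, [p] belongs to every cut pair [{a, b}]; for [a != p] it is the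
   second cut vertex. *)
have bE a : a \in Z -> a != p -> exists Ka, frag a Ka p.
  move=> aZ ap; have [Ka [b fr]] := fragP _ aZ; have [_ [f fKa _] _ _ _] := fr.
  case: (oth1 _ _ _ _ _ fr fKa pX (allK _ _ _ _ fr fKa) pL) => E; first by clash.
  by exists Ka; rewrite E.
have [a1 a1Z /andP[a1p _]] := card_pick2 p p Z3.
have [a2 a2Z /andP[a2p a21]] := card_pick2 p a1 Z3.
have [K1 [K1X [f1 f1K ef1] K1Z nbK1 typ1]] := bE _ a1Z a1p.
have [K2 [K2X [f2 f2K ef2] K2Z nbK2 typ2]] := bE _ a2Z a2p.
(* As [p] lies in [X], both fragments consist of common [h]-neighbours of [u] and [v], of which [X]
   has at most one. *)
have f12 : f1 = f2.
  symmetry; apply: (card_le1_eqP AB1); rewrite inE.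
    by rewrite (K1X _ f1K) (typ1 pX _ f1K).
  by rewrite (K2X _ f2K) (typ2 pX _ f2K).
rewrite -f12 in ef2; case: (nbK1 _ _ f1K ef2) => [E|E|a2K]; try clash.
by move: (K1Z _ a2K); rewrite a2Z.
Qed.

Lemma card_incl_excl (X : {set T}) (P Q : pred T) :
  #|[set x in X | ~~ P x && ~~ Q x]| + #|[set x in X | P x]| + #|[set x in X | Q x]|
  = #|X| + #|[set x in X | P x && Q x]|.
Proof.
rewrite -!sum_bool_card -sum1_card -!big_split /=; apply: eq_bigr => x _.
by case: (P x); case: (Q x).
Qed.

Lemma card_sep_union X Y u v (P : pred T) : sep e X Y u v ->
  #|[set x in X :|: Y | P x]| = #|[set x in X | P x]| + #|[set x in Y | P x]|.
Proof.
move=> s; rewrite -[RHS]cardsUI.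
have -> : [set x in X | P x] :&: [set x in Y | P x] = set0.
  apply/setP => x; rewrite !inE; apply/negP => /andP[/andP[xX _] /andP[xY _]].
  exact: sep_disj s xX xY.
rewrite cards0 addn0; apply: eq_card => x; rewrite !inE.
by case: (P x); rewrite ?andbT ?andbF.
Qed.

(** By [narrow_count], a side of size at least 3 is at most twice the number of [h]-edges from [u]
    and [v] into it. There are at most four such edges, so two sides of this kind total at most 8,
    not 9. If [Y] has two vertices, [X] has at least 7 and takes all four edges, which leads to
    [narrow_pair]. *)
Lemma narrow_bound X Y u v : sep e X Y u v -> 1 < #|X| -> 1 < #|Y| ->
  #|[set x in X :|: Y | h u x]| <= 2 -> #|[set x in X :|: Y | h v x]| <= 2 ->
  #|T| <= 10.
Proof.
wlog YX : X Y / #|Y| <= #|X|.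
  move=> hyp s X2 Y2; case/orP: (leq_total #|Y| #|X|) => YX; first exact: hyp.
  by rewrite setUC; apply: hyp => //; apply: sepC.
move=> s X2 Y2; rewrite !(card_sep_union _ s) => A2 B2.
rewrite leqNgt; apply/negP => T11; move: (T11); rewrite (card_sep s) => XY9.
have X3 : 2 < #|X| by lia.
have IEX := card_incl_excl X (h u) (h v); have IEY := card_incl_excl Y (h u) (h v).
have Hz a b : exists z, [/\ e u z, e v z, z != a & z != b].
  have [|z] := @card_pick2 _ [set x in X :|: Y | ~~ h u x && ~~ h v x] a b.
    by rewrite (card_sep_union _ s); lia.
  rewrite !inE => /and3P[zXY hu hv] /andP[za zb].
  have [zu zv] : z != u /\ z != v.
    case/orP: zXY => zD; last by rewrite (sep_neqa (sepC es s) zD) (sep_neqb (sepC es s) zD).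
    by rewrite (sep_neqa s zD) (sep_neqb s zD).
  by exists z; split=> //; apply: adj_of; rewrite // eq_sym.
have NX := narrow_count s X3 Y2 Hz.
case: (ltnP 2 #|Y|) => [Y3|Y2'].
  by have := narrow_count (sepC es s) Y3 X2 Hz; lia.
have Yc : #|Y| = 2 by lia.
have /eqP/cards2P[y [y' [yy' YE]]] := Yc.
apply: (narrow_pair s _ YE yy'); try lia.
move=> x xY; apply/andP; split; apply/negP => hx.
  have : 0 < #|[set x in Y | h u x]| by apply/card_gt0P; exists x; rewrite inE xY.
  lia.
have : 0 < #|[set x in Y | h v x]| by apply/card_gt0P; exists x; rewrite inE xY.
lia.
Qed.

(** * Wide cuts: many [h]-neighbours of both [u] and [v] *)

Lemma pendant_not_crit X Y u v x : sep e X Y u v -> 1 < #|X| -> x \in X ->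
  (forall y, e x y -> y = u \/ y = v) -> critv e x -> False.
Proof.
move=> s X2 xX nbx [K [M [w s']]].
(* [x] has neighbours on both sides of the cut [{x, w}], so [u] and [v] lie on opposite sides. *)
wlog [uK vM] : K M s' / u \in K /\ v \in M.
  move=> hyp; have [k kK exk] := sep_nbr es be s'.
  have [m mM exm] := sep_nbr es be (sepC es s').
  case: (nbx _ exk) (nbx _ exm) => kE [] mE; rewrite kE mE in kK mM.
  - exact: sep_disj s' kK mM.
  - exact: (hyp _ _ s').
  - exact: (hyp _ _ (sepC es s')).
  - exact: sep_disj s' kK mM.
have aux (D : {set T}) K' M' u' v' : sep e K' M' x w -> u' \in K' -> v' \in M' ->
    u' \notin D -> v' \notin D -> x \notin D -> w \notin D ->
    (forall d y, d \in D -> e d y -> [\/ y = u', y = v' | y \in D]) ->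
    forall d, d \in D -> d \notin K'.
  move=> s1 uK' vM' uD vD xD wD clD d dD; apply/negP => dK.
  case: (@biconn_closed _ e (K' :&: D) u' be).
  - by rewrite inE (negbTE uD) andbF.
  - by exists d; rewrite inE dK.
  - exists v'; first by rewrite inE (negbTE vD) andbF.
    by apply: contraTneq vM' => ->; apply/negP => /(sep_disj s1 uK').
  move=> d1 y /setIP[d1K d1D] edy yu; rewrite inE.
  case: (clD _ _ d1D edy) => [E|E|yD]; first by clash.
    by rewrite E (sep_edge s1 d1K vM') in edy.
  rewrite yD andbT; case: (sep_nb s1 d1K edy) => // E; clash.
(* Of a set [D] attached only to [u] and [v], the part in [K] would be cut off by [u] alone and the
   part in [M] by [v] alone. With [D := Y] this puts [w] into [Y]; then [D := X :\ x] gives the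
   contradiction. *)
have no (D : {set T}) : (exists d, d \in D) -> u \notin D -> v \notin D ->
    x \notin D -> w \notin D ->
    (forall d y, d \in D -> e d y -> [\/ y = u, y = v | y \in D]) -> False.
  move=> [d dD] uD vD xD wD clD.
  have dK := aux D K M u v s' uK vM uD vD xD wD clD d dD.
  have dM : d \notin M.
    apply: (aux D M K v u (sepC es s')) => // d1 y d1D /(clD _ _ d1D)[]; by constructor.
  by case: (sepP d s') => E; clash.
have wY : w \in Y.
  apply/negPn/negP => wY; apply: (no Y) => //.
  - exact: sep_r s.
  - exact: sep_aK (sepC es s).
  - exact: sep_bK (sepC es s).
  - by apply/negP => /(sep_disj s xX).
  - by move=> d y dY edy; apply: sep_nb (sepC es s) dY edy.
have wX : w \notin X by apply/negP => /(sep_disj s)/(_ wY).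
apply: (no (X :\ x)).
- by apply/card_gt0P; have := cardsD1 x X; rewrite xX; lia.
- by rewrite inE (negbTE (sep_aK s)) andbF.
- by rewrite inE (negbTE (sep_bK s)) andbF.
- by rewrite !inE eqxx.
- by rewrite inE (negbTE wX) andbF.
move=> d y /setD1P[dx dX] edy; case: (sep_nb s dX edy) => [||yX]; try by constructor.
constructor; rewrite !inE yX andbT; apply/negP => /eqP yx.
by move: edy; rewrite yx es => /nbx[] E; move: dX; rewrite E ?(negbTE (sep_aK s)) ?(negbTE (sep_bK s)).
Qed.

(** Every vertex of [X] is critical in [e] and every [e]-edge inside [X] is a 2-cut. A minimal side
    inside [X] then spans no edge, and any vertex of it contradicts [pendant_not_crit]. *)
Lemma thick_false X Y u v : sep e X Y u v -> 2 < #|X| -> 1 < #|Y| ->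
  2 < #|[set x in X :|: Y | h u x]| -> 2 < #|[set x | h v x]| -> False.
Proof.
move=> s X3 Y2 A3 B3.
have T3 : 2 < #|T| by rewrite (card_sep s); lia.
have critX a : a \in X -> critv e a.
  move=> aX; apply: (side_crit s X3 Y2 aX) => z.
  - have [x] := card_pick2 z a A3; rewrite inE => /andP[_ hux] /andP[xz xa].
    by exists x; split=> //; apply: cpl_neq.
  - have [x] := card_pick2 z a B3; rewrite inE => hux /andP[xz xa].
    by exists x; split=> //; apply: cpl_neq.
  have [x] := card_pick2 z a A3; rewrite inE => /andP[xXY hux] /andP[xz xa].
  by exists x; rewrite hux.
have cutX a b : a \in X -> b \in X -> e a b -> exists K L, sep e K L a b.
  move=> aX bX eab; apply: (side_cut s X3 Y2 aX bX eab) => z.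
  - have [|x [_ xz xb hux cux]] := nbr_ctr b z A3 (a := a).
      by rewrite eq_sym (sep_neqa s aX).
    by exists x; split=> //; apply: cpl_neq.
  - have [||x [_ xz xb hux cux]] := @nbr_ctr setT v a b z.
    - by rewrite (eq_card (B := [set x | h v x])) // => x; rewrite !inE.
    - by rewrite eq_sym (sep_neqb s aX).
    by exists x; split=> //; apply: cpl_neq.
  have [|x [xXY xz xb hux cux]] := nbr_ctr b z A3 (a := a).
    by rewrite eq_sym (sep_neqa s aX).
  by exists x; rewrite cux.
(* An edge inside a minimal side [E] would be a 2-cut with a smaller side. *)
suff main n (E L : {set T}) p q : #|E| <= n -> E \subset X -> sep e E L p q -> False.
  exact: (main _ _ _ _ _ (leqnn _) (subxx _) s).
elim: n => [|n IHn] in E L p q *.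
  by rewrite leqn0 => /eqP En0 _ sE; have [x] := sep_l sE; rewrite (cards0_eq En0) inE.
move=> En /subsetP EX sE.
case: (boolP [exists a in E, exists b in E, e a b]) => [|noedge].
  case/exists_inP => a aE /exists_inP[b bE eab].
  have [K [M sab]] := cutX _ _ (EX _ aE) (EX _ bE) eab.
  (* If [L] meets [K'], then [p] and [q] both lie in [K']: were one missing, the other alone would
     cut off [L :&: K']. The opposite side is thereby trapped inside [E]. *)
  have inK K' M' p' q' l : sep e K' M' a b -> sep e E L p' q' ->
      l \in L -> l \in K' -> p' \in K'.
    move=> s1 s2 lL lK; apply/negPn/negP => pK.
    case: (@biconn_closed _ e (L :&: K') q' be).
    - by rewrite inE (negbTE (sep_bK (sepC es s2))).
    - by exists l; rewrite inE lL.
    - by exists p'; [rewrite inE (negbTE pK) andbF|apply: sep_neq s2].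
    move=> x y /setIP[xL xK] exy yq; rewrite inE.
    have yE : y \notin E.
      by apply/negP => yE; rewrite es (sep_edge s2 yE xL) in exy.
    have yK : y \in K'.
      by case: (sep_nb s1 xK exy) => // E0; rewrite -E0 ?(negbTE yE) in aE bE.
    by rewrite yK andbT; case: (sep_nb (sepC es s2) xL exy) => // E0; clash.
  have fin K' M' l : sep e K' M' a b -> l \in L -> l \in K' -> False.
    move=> s1 lL lK.
    have pK := inK _ _ _ _ _ s1 sE lL lK.
    have qK := inK _ _ _ _ _ s1 (sep_swap sE) lL lK.
    have ME : M' \subset E.
      apply/subsetP => m mM; case: (sepP m sE) => // [mE|mE|mL].
      - by case: (sep_disj s1 pK); rewrite -mE.
      - by case: (sep_disj s1 qK); rewrite -mE.
      have pM := inK _ _ _ _ _ (sepC es s1) sE mL mM.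
      by case: (sep_disj s1 pK pM).
    apply: (IHn M' K' a b); last exact: sepC.
      rewrite -ltnS; apply: leq_trans En; apply: proper_card.
      by apply/properP; split=> //; exists a => //; apply: sep_aK (sepC es s1).
    by apply: subset_trans ME _; apply/subsetP.
  have [l lL] := sep_r sE.
  case: (sepP l sab) => [lE|lE|lK|lM].
  - by apply: (sep_disj sE aE); rewrite -lE.
  - by apply: (sep_disj sE bE); rewrite -lE.
  - exact: fin sab lL lK.
  - exact: fin (sepC es sab) lL lM.
have [x xE] := sep_l sE.
have nbx y : e x y -> y = p \/ y = q.
  move=> exy; case: (sep_nb sE xE exy) => [||yE]; [by left|by right|].
  case/negP: noedge; apply/exists_inP; exists x => //.
  by apply/exists_inP; exists y.
have xX := EX _ xE.
(* If [r] were in [X], the edge from [x] to [r] would be a 2-cut, with only [r'] left as neighbour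
   of [x] on both sides. *)
have nX r r' : e x r -> (forall y, e x y -> y = r \/ y = r') -> r \notin X.
  move=> exr nbr; apply/negP => rX; have [K [M s1]] := cutX _ _ xX rX exr.
  have [k kK /nbr[kE|kE]] := sep_nbr es be s1; rewrite kE in kK.
    by have := sep_bK s1; rewrite kK.
  have [m mM /nbr[mE|mE]] := sep_nbr es be (sepC es s1); rewrite mE in mM.
    by have := sep_bK (sepC es s1); rewrite mM.
  exact: sep_disj s1 kK mM.
apply: (pendant_not_crit s _ xX _ (critX _ xX)); first by lia.
move=> y exy; case: (sep_nb s xX exy) => [||yX]; [by left|by right|].
case: (nbx _ exy) => yE; rewrite yE in exy yX.
  by have := nX p q exy nbx; rewrite yX.
suff : q \notin X by rewrite yX.
by apply: (nX q p exy) => z /nbx[]; [right|left].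
Qed.

(** * Wide cuts: many [h]-neighbours of [u], at most two of [v] *)

Lemma mixed_count X Y u v : sep e X Y u v -> 2 < #|X| -> 1 < #|Y| ->
  2 < #|[set x in X :|: Y | h u x]| -> #|[set x | h v x]| <= 2 ->
  #|[set x in X | ~~ h v x]| <= 2 * #|[set x in X | h v x]| + h u v.
Proof.
move=> s X3 Y2 A3 B2; set P := [set x in X | ~~ h v x].
have T3 : 2 < #|T| by rewrite (card_sep s); lia.
have uv := sep_neq s; have sC := sepC es s.
have PX x : x \in P -> x \in X by rewrite inE => /andP[].
have Ph x : x \in P -> ~~ h v x by rewrite inE => /andP[].
have nbv z a : ~~ h v a -> exists x, [/\ x != z, x != a, x != v & h v x].
  move=> nva; have [x [xz xv hvx]] := biconn_deg2 v z bh T3.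
  by exists x; split=> //; apply: contraNneq nva => <-.
have critP a : a \in P -> critv e a.
  move=> aP; apply: (side_crit s X3 Y2 (PX _ aP)) => z.
  - have [x] := card_pick2 z a A3; rewrite inE => /andP[_ hux] /andP[xz xa].
    by exists x; split=> //; apply: cpl_neq.
  - exact: nbv (Ph _ aP).
  have [x] := card_pick2 z a A3; rewrite inE => /andP[xXY hux] /andP[xz xa].
  by exists x; rewrite hux.
have cutP a b : a \in P -> b \in P -> e a b -> exists K L, sep e K L a b.
  move=> aP bP eab; have aX := PX _ aP; have bX := PX _ bP.
  apply: (side_cut s X3 Y2 aX bX eab) => z.
  - have [|x [_ xz xb hux cux]] := nbr_ctr b z A3 (a := a).
      by rewrite eq_sym (sep_neqa s aX).
    by exists x; split=> //; apply: cpl_neq.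
  - have [x [xz xb xv hvx]] := nbv z b (Ph _ bP); exists x; split=> //.
    have xa : x != a by apply: contraTneq hvx => ->; apply: Ph.
    by rewrite /ctr /= hvx (negbTE xa) eq_sym (negbTE (sep_neqb s aX)).
  have [|x [xXY xz xb hux cux]] := nbr_ctr b z A3 (a := a).
    by rewrite eq_sym (sep_neqa s aX).
  by exists x; rewrite cux.
pose clo (K : {set T}) a b :=
  forall x y, x \in K -> e x y -> [\/ y = a, y = b | y \in K].
pose inner a f := exists (K : {set T}) b,
  [/\ f \in K, forall x, x \in K -> h v x & clo K a b].
pose beyond a f := exists K : {set T}, [/\ f \in K, {subset K <= X} & clo K a v].
pose around a f := exists (K : {set T}) b, [/\ f \in K, u \in K, b \in Y,
  forall x, x \in K -> x != u -> h v x & clo K a b].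
(* Keep the side that avoids [v], and also [u] when [b = v]. If it avoids [u] it lies in [X], giving
   [inner] or, for [b = v], [beyond]; if it contains [u], then [b] is in [Y], giving [around]. *)
have types a b K L : a \in P -> sep e K L a b ->
    exists f, e f a /\
     [\/ f \in X /\ inner a f, [/\ b = v, f \in X & beyond a f] |
         [/\ h u v, b \in Y & around a f]].
  move=> aP; wlog [vK buK] : K L / v \notin K /\ (b = v -> u \notin K).
    move=> hyp s'; have sC' := sepC es s'; have aX := PX _ aP.
    have out M N w : sep e M N a b -> w \in N -> w \notin M.
      by move=> s1 wN; apply/negP => /(sep_disj s1)/(_ wN).
    case: (eqVneq b v) => [bv|bv].
      case: (sepP u s') => [E|E|uK|uL].
      - by have := sep_neqa s aX; rewrite E eqxx.
      - by rewrite E bv eqxx in uv.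
      - apply: (hyp L K) => //; split=> [|_]; last by apply: out uK.
        by rewrite -bv; apply: sep_bK sC'.
      - apply: (hyp K L) => //; split=> [|_]; last by apply: out uL.
        by rewrite -bv; apply: sep_bK s'.
    case: (sepP v s') => [E|E|vK|vL].
    - by have := sep_neqb s aX; rewrite E eqxx.
    - by rewrite E eqxx in bv.
    - by apply: (hyp L K) => //; split=> [|E]; [apply: out vK|rewrite E eqxx in bv].
    - by apply: (hyp K L) => //; split=> [|E]; [apply: out vL|rewrite E eqxx in bv].
  move=> s'; have aX := PX _ aP.
  have [f fK eaf] := sep_nbr es be s'; exists f; split; first by rewrite es.
  have clK : clo K a b by move=> x y xK exy; apply: sep_nb s' xK exy.
  (* A nonempty [K :&: Y] would be separated from the rest by [z] alone; [z] is [b] if [u] is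
     outside [K], and [u] otherwise. *)
  have noY z : z \notin K :&: Y ->
      (forall x y, x \in K -> x \in Y -> e x y -> y != z -> y = b -> False) ->
      (u \in K -> z = u) -> forall x, x \in K -> x \notin Y.
    move=> zKY zb zu x xK; apply/negP => xY.
    case: (@biconn_closed _ e (K :&: Y) z be zKY).
    - by exists x; rewrite inE xK.
    - case: (eqVneq z a) => [->|az].
        exists v; first by rewrite inE (negbTE vK).
        by rewrite eq_sym (sep_neqb s aX).
      by exists a; [rewrite inE (negbTE (sep_aK s'))|rewrite eq_sym].
    move=> x1 y /setIP[x1K x1Y] exy yz; rewrite inE.
    have ya : y != a by apply: contraTneq exy => ->; rewrite es (sep_edge s aX x1Y).
    have yK : y \in K.
      case: (clK _ _ x1K exy) => // E; first by clash.
      by case: (zb _ _ x1K x1Y exy yz E).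
    rewrite yK; case: (sep_nb sC x1Y exy) => // E; last by clash.
    by rewrite E in yK yz; rewrite (zu yK) eqxx in yz.
  case: (boolP (u \in K)) => uK; last first.
    have KX x : x \in K -> x \in X.
      move=> xK; case: (sepP x s) => // [E|E|xY]; try clash.
      suff /negP : x \notin Y by [].
      apply: (noY b) => //.
      - by rewrite inE (negbTE (sep_bK s')).
      - by move=> x1 y _ _ _ yb E; clash.
      - by rewrite (negbTE uK).
    case: (eqVneq b v) => [bv|bv].
      by constructor 2; split=> //; [apply: KX|exists K; split=> //; rewrite -bv].
    constructor 1; split; first exact: KX.
    exists K, b; split=> // x xK; apply: cpl_of.
      by rewrite eq_sym (sep_neqb s (KX _ xK)).
    rewrite es; apply/negP => exv.
    case: (clK _ _ xK exv) => E; try clash.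
    by have := sep_neqb s aX; rewrite E eqxx.
  have bv : b != v by apply/eqP => /buK; rewrite uK.
  have va : v != a by rewrite eq_sym (sep_neqb s aX).
  have hv x : x \in K -> x != v -> h v x.
    move=> xK xv; apply: cpl_of; rewrite 1?eq_sym //.
    rewrite es; apply/negP => exv.
    case: (clK _ _ xK exv) => E; clash.
  have bY : b \in Y.
    apply/negPn/negP => bY; have [y yY euy] := sep_nbr es be sC.
    case: (clK _ _ uK euy) => [E|E|yK].
    - by rewrite -E in aX; case: (sep_disj s aX yY).
    - by rewrite E in yY; clash.
    suff /negP : y \notin Y by [].
    apply: (noY u) => //; first by rewrite inE (negbTE (sep_aK sC)) andbF.
    move=> x1 y1 x1K x1Y exy yu E.
    by case: (sep_nb sC x1Y exy) => E1; rewrite E in E1 yu; clash.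
  constructor 3; split=> //; first by rewrite hs; apply: hv.
  exists K, b; split=> // x xK xu; apply: hv => //; try clash.
  by apply: contraNneq vK => <-.
pose noP a := forall b, b \in P -> ~~ e a b.
(* Type [around] is sent to [u], the others to an [h]-neighbour of [v] in [X]. If [a] has an
   [e]-neighbour in [P], that edge is a 2-cut of type [inner]; if not, every neighbour of [a] in
   [X], in particular [f], is an [h]-neighbour of [v]. *)
pose Q a f := a \in P ->
  [\/ [/\ f \in X, h v f, e f a & inner a f],
      [/\ f \in X, h v f, e f a & noP a /\ beyond a f]
    | [/\ f = u, h u v & exists2 f', e f' a & around a f']].
have [phi phiP] : exists phi, forall a, Q a (phi a).
  apply: fin_all_exists => a; case: (boolP (a \in P)) => aP; last by exists a => /(negP aP).
  have inn f : inner a f -> h v f by case=> K [b [fK Kh _]]; apply: Kh.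
  case: (boolP [exists b in P, e a b]) => [/exists_inP[b bP eab]|].
    have [K [L sab]] := cutP _ _ aP bP eab.
    have [f [efa [[fX typ]|[bv _ _]|[_ bY _]]]] := types _ _ _ _ aP sab.
    - by exists f => _; constructor 1; split=> //; apply: inn.
    - by have := sep_neqb s (PX _ bP); rewrite bv eqxx.
    - by case: (sep_disj s (PX _ bP) bY).
  rewrite negb_exists_in => /forall_inP noe.
  have [K [L [b sab]]] := critP _ aP.
  have [f [efa [[fX typ]|[bv fX typ]|[huv bY typ]]]] := types _ _ _ _ aP sab.
  - by exists f => _; constructor 1; split=> //; apply: inn.
  - exists f => _; constructor 2; split=> //; apply/negPn/negP => hvf.
    by have := noe f; rewrite es efa inE fX hvf => /(_ isT).
  - by exists u => _; constructor 3; split=> //; exists f.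
have B3 x y z : h v x -> h v y -> h v z -> y != x -> z != x -> y = z.
  move=> hx hy hz yx zx; apply/eqP/negPn/negP => yz.
  have /subset_leq_card : [set x; y; z] \subset [set x | h v x].
    by apply/subsetP => w; rewrite !inE => /orP[/orP[]|] /eqP->.
  rewrite -setUA !cardsU1 cards1 !inE negb_or (eq_sym x y) (eq_sym x z) yx zx yz.
  lia.
have uX : u \notin X := sep_aK s.
have -> : 2 * #|[set x in X | h v x]| + h u v =
    \sum_(f in u |: [set x in X | h v x]) (if f == u then h u v : nat else 2).
  rewrite big_setU1 ?inE ?(negbTE uX) //= eqxx addnC mulnC -sum_nat_const; congr (_ + _).
  by apply: eq_bigr => f; rewrite inE => /andP[fX _]; rewrite (negbTE (sep_neqa s fX)).
apply: (@card_fiber_le _ P _ phi (fun f => if f == u then h u v : nat else 2)).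
  move=> a aP; rewrite !inE.
  by case: (phiP a aP) => [[-> -> _ _]|[-> -> _ _]|[-> _ _]]; rewrite ?orbT ?eqxx.
move=> f fD; set F := [set a in P | _].
have FP a : a \in F -> [/\ a \in P, phi a = f & Q a f].
  by rewrite inE => /andP[aP /eqP <-].
case: (eqVneq f u) => [fu|fu].
  have arr a : a \in F -> h u v /\ exists2 f', e f' a & around a f'.
    case/FP => aP _ /(_ aP)[[fX]|[fX]|[_ ? ?]] //.
      by rewrite -fu fX in uX.
    by rewrite -fu fX in uX.
  have [->|[a aF]] := set_0Vmem F; first by rewrite cards0.
  have [huv _] := arr _ aF; rewrite huv; apply/card_le1_eqP.
  (* A neighbour of both [a1] and [a2] inside the side of [a1] would put [a2] there, making it an
     [h]-neighbour of [v]. So [f1] and [f2] differ from each other and from [u], and [v] gets three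
     [h]-neighbours. *)
  suff half a1 a2 : a1 \in F -> a2 \in F -> a1 != a2 ->
      forall f1 f2, around a1 f1 -> f1 = f2 -> e f2 a2 -> False.
    move=> a2 a1 /= a2F a1F; apply/eqP/negPn/negP => a12.
    have [_ [f1 ef1 ar1]] := arr _ a1F; have [_ [f2 ef2 ar2]] := arr _ a2F.
    have nu a' a'' g g' : a' \in F -> a'' \in F -> a' != a'' -> around a' g ->
        e g' a'' -> g' != u.
      move=> a'F a''F ne ar' eg; apply/negP => /eqP gu; rewrite gu in eg.
      have [K [b [_ uK bY Kh cl]]] := ar'.
      apply: (half a' a'' a'F a''F ne u u) => //.
      by exists K, b.
    have a21 : a2 != a1 by rewrite eq_sym.
    have f2u := nu _ _ _ _ a1F a2F a12 ar1 ef2.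
    have f1u := nu _ _ _ _ a2F a1F a21 ar2 ef1.
    apply: (half a1 a2 a1F a2F a12 f1 f2) => //.
    have hvu : h v u by rewrite hs.
    have hf a' g : around a' g -> g != u -> h v g.
      by case=> K [b [gK _ _ Kh _]]; apply: Kh.
    by apply: (B3 u); [| apply: hf ar1 f1u| apply: hf ar2 f2u| |].
  move=> a1F a2F a12 f1 f2 [K [b [f1K uK bY Kh cl]]] <- ef.
  have [a2P _ _] := FP _ a2F.
  case: (cl _ _ f1K ef) => [E|E|a2K].
  - by rewrite E eqxx in a12.
  - by rewrite -E in bY; case: (sep_disj s (PX _ a2P) bY).
  have a2u : a2 != u := sep_neqa s (PX _ a2P).
  by have := Kh _ a2K a2u; rewrite (negbTE (Ph _ a2P)).
have Q' a : a \in F -> e f a /\ (inner a f \/ noP a /\ beyond a f) /\ h v f.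
  case/FP => aP _ /(_ aP)[[fX hvf efa]|[fX hvf efa]|[E]]; last by rewrite E eqxx in fu.
    by split=> //; split=> //; left.
  by split=> //; split=> //; right.
rewrite leqNgt; apply/negP => F3.
(* A fibre element off [a] and [b] is adjacent to [f], so it lies in [K] and is an [h]-neighbour of
   [v], contrary to [P]. *)
have inn a : a \in F -> inner a f -> False.
  move=> aF [K [b [fK Kh cl]]].
  have [a' a'F /andP[a'a a'b]] := card_pick2 a b F3.
  have [efa' _] := Q' _ a'F; have [a'P _ _] := FP _ a'F.
  case: (cl _ _ fK efa') => [E|E|a'K]; try clash.
  by have := Kh _ a'K; rewrite (negbTE (Ph _ a'P)).
have bey a : a \in F -> [/\ a \in P, e f a, noP a & beyond a f].
  move=> aF; have [aP _ _] := FP _ aF; have [efa [[ia|[? ?]] _]] := Q' _ aF => //.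
  by case: (inn _ aF ia).
have [a1 a1F _] := card_pick2 u u F3.
have [a2 a2F /andP[a21 _]] := card_pick2 a1 a1 F3.
have [_ [_ hvf]] := Q' _ a1F.
have half a a' (K : {set T}) : a \in F -> a' \in F -> a' != a -> f \in K -> {subset K <= X} ->
    clo K a v -> a' \in K /\ ~~ e a' u.
  move=> aF a'F a'a fK KX cl; have [a'P efa' _ _] := bey _ a'F.
  have a'K : a' \in K.
    case: (cl _ _ fK efa') => // E; first by clash.
    by have := sep_neqb s (PX _ a'P); rewrite E eqxx.
  split=> //; apply/negP => eu; case: (cl _ _ a'K eu) => E.
  - by have [aP _ _ _] := bey _ aF; move: (PX _ aP); rewrite -E (negbTE uX).
  - by rewrite E eqxx in uv.
  - by move: (KX _ E); rewrite (negbTE uX).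
(* Without an exit [y], the set [a |: K] would be cut off by [v] alone. Besides [f] there is at most
   one [h]-neighbour of [v], so the exits of [a1] and [a2] coincide; but [a2] lies in [K1] and
   cannot reach the exit of [a1]. *)
have exit a (K : {set T}) : a \in F -> ~~ e a u -> f \in K -> {subset K <= X} -> clo K a v ->
    exists y, [/\ y \in X, e a y, y \notin K & h v y].
  move=> aF nau fK KX cl; have [aP efa nP _] := bey _ aF.
  case: (boolP [exists y in X, e a y && (y \notin K)]) => [|noy].
    case/exists_inP => y yX /andP[eay yK]; exists y; split=> //.
    apply/negPn/negP => hvy; have := nP y; rewrite eay inE yX hvy => /(_ isT).
    by [].
  case: (@biconn_closed _ e (a |: K) v be).
  - rewrite !inE negb_or eq_sym (sep_neqb s (PX _ aP)) /=.
    by apply/negP => /KX; rewrite (negbTE (sep_bK s)).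
  - by exists a; rewrite !inE eqxx.
  - exists u => //; rewrite !inE negb_or eq_sym (sep_neqa s (PX _ aP)) /=.
    by apply/negP => /KX; rewrite (negbTE uX).
  move=> x y; rewrite !inE => /orP[/eqP->|xK] exy yv.
    case: (sep_nb s (PX _ aP) exy) => [E|E|yX]; last 2 first.
    - by clash.
    - apply/orP; right; apply/negPn/negP => yK; case/negP: noy.
      by apply/exists_inP; exists y; rewrite // exy.
    by rewrite E (negbTE nau) in exy.
  case: (cl _ _ xK exy) => [->|E|->]; rewrite ?eqxx ?orbT //; clash.
have [a1P _ _ [K1 [fK1 K1X cl1]]] := bey _ a1F.
have [a2P _ _ [K2 [fK2 K2X cl2]]] := bey _ a2F.
have a12 : a1 != a2 by rewrite eq_sym.
have [a2K1 na2u] := half _ _ _ a1F a2F a21 fK1 K1X cl1.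
have [a1K2 na1u] := half _ _ _ a2F a1F a12 fK2 K2X cl2.
have [y1 [y1X ey1 y1K hy1]] := exit _ _ a1F na1u fK1 K1X cl1.
have [y2 [y2X ey2 y2K hy2]] := exit _ _ a2F na2u fK2 K2X cl2.
have y12 : y1 = y2.
  apply: (B3 f) => //.
    by apply: contraNneq y1K => ->.
  by apply: contraNneq y2K => ->.
rewrite -y12 in ey2; case: (cl1 _ _ a2K1 ey2) => [E|E|y1K1]; last by clash.
  by rewrite E (tight_irr tg) in ey1.
by have := sep_neqb s y1X; rewrite E eqxx.
Qed.

(** A side of size at least 3 with [k] [h]-neighbours of [v] has at most [3 * k + h u v] vertices.
    As [v] has at most two [h]-neighbours, [X] has at most 6, and so do both sides together when [Y]
    is also that large; more than 10 vertices would require 7 and 9. *)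
Lemma mixed_bound X Y u v : sep e X Y u v -> 1 < #|X| -> 1 < #|Y| ->
  2 < #|[set x in X :|: Y | h u x]| -> #|[set x | h v x]| <= 2 -> #|T| <= 10.
Proof.
wlog YX : X Y / #|Y| <= #|X|.
  move=> hyp s X2 Y2; case/orP: (leq_total #|Y| #|X|) => YX; first exact: hyp.
  by rewrite setUC; apply: hyp => //; apply: sepC.
move=> s X2 Y2 A3 B2; rewrite (card_sep s) leqNgt; apply/negP => XY9.
have X3 : 2 < #|X| by lia.
have NX := mixed_count s X3 Y2 A3 B2.
have split_card (D : {set T}) : #|[set x in D | ~~ h v x]| + #|[set x in D | h v x]| = #|D|.
  rewrite -(cardsID [set x | h v x] D) addnC; congr (_ + _); apply: eq_card => x;
    by rewrite !inE // andbC.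
have SX := split_card X; have SY := split_card Y.
have : #|[set x in X | h v x]| + #|[set x in Y | h v x]| + h u v <= 2.
  apply: leq_trans B2; rewrite -(card_sep_union _ s) (cardsD1 u [set x | h v x]) inE hs addnC.
  rewrite leq_add2l; apply: subset_leq_card; apply/subsetP => x; rewrite !inE.
  case/andP=> xXY ->; rewrite andbT.
  by case/orP: xXY => xD; [exact: sep_neqa s xD | exact: sep_neqa (sepC es s) xD].
case: (ltnP 2 #|Y|) => [Y3|Y2'] ; last by lia.
have NY := mixed_count (sepC es s) Y3 X2.
rewrite setUC in NY; have := NY A3 B2; lia.
Qed.

(** The counts inside [X :|: Y] and in the whole graph differ only by a possible [h]-edge between
    [u] and [v]; exchanging [u] and [v] covers the asymmetric cases. *)
Lemma wide_bound X Y u v : sep e X Y u v -> 1 < #|X| -> 1 < #|Y| -> #|T| <= 10.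
Proof.
wlog YX : X Y / #|Y| <= #|X|.
  move=> hyp s X2 Y2; case/orP: (leq_total #|Y| #|X|) => YX; first exact: hyp s X2 Y2.
  by apply: hyp (sepC es s) _ _.
move=> s X2 Y2; case: (leqP #|T| 10) => // T11; have XY := card_sep s.
have X3 : 2 < #|X| by lia.
case: (leqP #|[set x in X :|: Y | h u x]| 2) => A; last first.
  case: (leqP #|[set x | h v x]| 2) => B; first by have := mixed_bound s X2 Y2 A B; lia.
  by case: (thick_false s X3 Y2 A B).
case: (leqP #|[set x in X :|: Y | h v x]| 2) => B; first by have := narrow_bound s X2 Y2 A B; lia.
have s' := sep_swap s.
case: (leqP #|[set x | h u x]| 2) => B'; first by have := mixed_bound s' X2 Y2 B B'; lia.
by case: (thick_false s' X3 Y2 B B').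
Qed.
End WideCut.

(** * 2-cuts that isolate one vertex *)

Lemma card_bigcup_leq (T I : finType) (A : {set I}) (F : I -> {set T}) :
  #|\bigcup_(i in A) F i| <= \sum_(i in A) #|F i|.
Proof.
elim/big_rec2: _ => [|i n B _ IH]; first by rewrite cards0.
by rewrite cardsU; lia.
Qed.

Section Neighbourhoods.
Variable T : finType.
Implicit Types (e h : rel T) (x y : T).

Definition nb e x : {set T} := [set y | e x y].
Definition deg2 e : {set T} := [set x | #|nb e x| == 2].

Definition cut_edge e p q : rel T :=
  [rel x y | [&& e x y, ~~ ((x == p) && (y == q)) & ~~ ((x == q) && (y == p))]].

Lemma cut_edge_sym e p q : symmetric e -> symmetric (cut_edge e p q).
Proof.
move=> es x y; rewrite /cut_edge /= es; congr (_ && _).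
by rewrite andbC; congr (~~ _ && ~~ _); rewrite andbC.
Qed.

Lemma in_nb e x y : (y \in nb e x) = e x y.
Proof. by rewrite inE. Qed.

Lemma deg2P e x : reflect (exists p q, p != q /\ nb e x = [set p; q]) (x \in deg2 e).
Proof. by rewrite /deg2 inE; exact: cards2P. Qed.

Lemma card_nb_cpl e h : irreflexive e ->
  (forall x y, h x y = (x != y) && ~~ e x y) ->
  forall x, #|nb e x| + #|nb h x| = #|T|.-1.
Proof.
move=> ei hE x; have -> : #|T|.-1 = #|[set~ x]| by have := cardsC1 x; lia.
rewrite -(cardsID (nb e x) [set~ x]); congr (_ + _); apply: eq_card => y; rewrite !inE.
  by case: eqP => [->|]; rewrite ?ei.
by rewrite hE eq_sym andbC.
Qed.

End Neighbourhoods.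

Section NarrowCuts.
Variables (T : finType) (e h : rel T).
Hypothesis tg : tight e h.
Hypothesis T11 : 10 < #|T|.
Let es := tight_sym tg.
Let hE := tight_cpl tg.
Let hs := cpl_sym es hE.
Let be := tight_biconn tg.
Let bh := tight_cobiconn tg.
Let card_nb := card_nb_cpl (tight_irr tg) hE.

(** Both cut vertices have a neighbour in the singleton side, so its vertex is adjacent to exactly
    these two. *)
Lemma crit_deg2 v :
  (forall K L a b, sep e K L a b -> #|K| <= 1 \/ #|L| <= 1) ->
  critv e v -> exists2 s, s \in deg2 e & e s v.
Proof.
move=> thin [K [L [z s]]]; wlog K1 : K L s / #|K| <= 1.
  by move=> hyp; case: (thin _ _ _ _ s); [apply: hyp s|apply: hyp (sepC es s)].
have [x xK evx] := sep_nbr es be s; have [y yK ezy] := sep_nbr2 es be s.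
have yx : y = x by apply: (card_le1_eqP K1).
rewrite yx in ezy; exists x; last by rewrite es.
apply/deg2P; exists v, z; split; first exact: sep_neq s.
apply/setP => w; rewrite !inE; apply/idP/orP => [exw|[]/eqP->]; last 2 first.
- by rewrite es.
- by rewrite es.
case: (sep_nb s xK exw) => [->|->|wK]; [by left|by right|].
have wx : w = x by apply: (card_le1_eqP K1).
by rewrite wx (tight_irr tg) in exw.
Qed.

Lemma deg2_disj x : x \in deg2 e -> x \in deg2 h -> False.
Proof. by rewrite !inE => /eqP E1 /eqP E2; have := card_nb x; lia. Qed.

Let S := deg2 e.
Let D := deg2 h.
Hypothesis cover : forall v, (exists2 s, s \in S & e s v) \/ (exists2 t, t \in D & h t v).

Let CG := \bigcup_(s in S) nb e s.

Lemma CG_P v : reflect (exists2 s, s \in S & e s v) (v \in CG).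
Proof.
apply: (iffP bigcupP) => -[s sS]; first by rewrite in_nb; exists s.
by move=> esv; exists s; rewrite ?in_nb.
Qed.

Lemma card_deg2_nb (c : rel T) s : s \in deg2 c -> #|nb c s| = 2.
Proof. by rewrite inE => /eqP. Qed.

Lemma card_CG : #|CG| <= 2 * #|S|.
Proof.
apply: leq_trans (card_bigcup_leq _ _) _; rewrite mulnC -sum_nat_const.
by apply: leq_sum => s sS; rewrite card_deg2_nb.
Qed.

(** If both sets have at least three elements, [c2] becomes [#|T| <= 3 * #|S| + 3 * #|D| - #|S| *
    #|D|], which is at most 9. For [#|S| = 2], [c1] gives 10, and for [#|D| = 2], [c3] does. *)
Lemma many_bound : 2 <= #|S| -> 2 <= #|D| -> False.
Proof.
move=> S2 D2.
pose a := \sum_(s in S) #|nb e s :&: D|.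
pose a' := \sum_(s in S) #|nb e s :\: D|.
pose b' := \sum_(t in D) #|nb h t :\: S|.
have aa' : a + a' = 2 * #|S|.
  rewrite mulnC -sum_nat_const -big_split /=; apply: eq_bigr => s sS.
  by rewrite cardsID card_deg2_nb.
(* [S] and [D] are disjoint, so each pair between them is an edge of exactly one of [e] and [h]; [a]
   counts those of [e]. *)
have bb' : b' + #|S| * #|D| = 2 * #|D| + a.
  have -> : a = \sum_(t in D) #|nb e t :&: S|.
    transitivity (\sum_(s in S) \sum_(t in D) (e s t : nat)).
      apply: eq_bigr => s _; rewrite sum_bool_card; apply: eq_card => t.
      by rewrite !inE andbC.
    rewrite exchange_big /=; apply: eq_bigr => t _.
    rewrite sum_bool_card; apply: eq_card => s.
    by rewrite !inE es andbC.
  rewrite mulnC -sum_nat_const [2 * _]mulnC -sum_nat_const -!big_split /=.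
  apply: eq_bigr => t tD; rewrite -(card_deg2_nb tD) -(cardsID S (nb h t)).
  suff : #|nb h t :&: S| + #|nb e t :&: S| = #|S| by lia.
  rewrite -(cardsID (nb h t) S) setIC; congr (_ + _); apply: eq_card => s.
  rewrite in_setI in_setD !in_nb; case sS: (s \in S); rewrite ?andbF ?andbT //.
  have ts : t != s by apply/eqP => E; rewrite E in tD; apply: deg2_disj sS tD.
  by rewrite hE ts /= negbK.
have c1 : #|T| <= #|S| + #|CG| + b'.
  have : #|S :|: CG :|: \bigcup_(t in D) (nb h t :\: S)| = #|T|.
    rewrite -cardsT; apply: eq_card => v; rewrite !in_setU in_setT.
    case vS: (v \in S) => //=; case vC: (v \in CG) => //=; apply/bigcupP.
    case: (cover v) => [/CG_P|[t tD htv]]; first by rewrite vC.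
    by exists t; rewrite // in_setD in_nb vS.
  move=> <-; have := card_bigcup_leq D (fun t => nb h t :\: S); rewrite -/b' !cardsU; lia.
have c2 : #|T| <= #|S| + #|D| + a' + b'.
  have : #|S :|: D :|: \bigcup_(s in S) (nb e s :\: D) :|: \bigcup_(t in D) (nb h t :\: S)| = #|T|.
    rewrite -cardsT; apply: eq_card => v; rewrite !in_setU in_setT.
    case vS: (v \in S) => //=; case vD: (v \in D) => //=.
    apply/orP; case: (cover v) => -[w wD cwv]; [left|right]; apply/bigcupP; exists w => //.
      by rewrite in_setD in_nb vD.
    by rewrite in_setD in_nb vS.
  move=> <-; have := card_bigcup_leq D (fun t => nb h t :\: S).
  have := card_bigcup_leq S (fun t => nb e t :\: D); rewrite -/b' -/a' !cardsU; lia.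
have c3 : #|T| <= 3 * #|D| + a'.
  have : #|D :|: \bigcup_(t in D) nb h t :|: \bigcup_(s in S) (nb e s :\: D)| = #|T|.
    rewrite -cardsT; apply: eq_card => v; rewrite !in_setU in_setT.
    case vD: (v \in D) => //=.
    apply/orP; case: (cover v) => -[w wD cwv]; [right|left]; apply/bigcupP; exists w => //.
      by rewrite in_setD in_nb vD.
    by rewrite in_nb.
  move=> <-; have := card_bigcup_leq D (fun t => nb h t).
  have -> : \sum_(t in D) #|nb h t| = #|D| * 2.
    by rewrite -sum_nat_const; apply: eq_bigr => t; apply: card_deg2_nb.
  have := card_bigcup_leq S (fun t => nb e t :\: D); rewrite -/a' !cardsU; lia.
have cC := card_CG.
case: (leqP #|S| 2) => [S2'|S3].
  by move: bb' cC aa' c1; (have -> : #|S| = 2 by lia); lia.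
case: (leqP #|D| 2) => [D2'|D3].
  by move: bb' c3; (have -> : #|D| = 2 by lia); lia.
have : 3 * #|S| + 3 * #|D| <= #|S| * #|D| + 9 by move: S3 D3; nia.
lia.
Qed.

(** In [e], [t] is adjacent to all other vertices but [p] and [q], so contracting the [h]-edge [pt]
    removes from [e] only [t] and the edge [pq]. As [t] is not critical in [e], that edge crosses
    the separation. The pair [{p, t}] is no 2-cut of [h]: [t] has only [q] left to reach both
    sides. *)
Lemma deg2_bridge t : t \in D -> t \notin CG ->
  (forall v, critv e v -> exists2 s, s \in S & e s v) ->
  exists p q z P Q, [/\ nb h t = [set p; q], sep (cut_edge e p q) P Q t z,
    p \in P, q \in Q & e p q].
Proof.
move=> tD tC cS; have [p [q [pq nbt]]] := deg2P _ _ tD.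
have htx x : h t x = (x == p) || (x == q) by rewrite -in_nb nbt !inE.
have htp : h p t by rewrite hs htx eqxx.
case: (tight_coctr tg htp) => [[K [L s]]|[K [L [z s]]]].
  have [k kK] := sep_nbr2 hs bh s; have [l lL] := sep_nbr2 hs bh (sepC hs s).
  rewrite !htx (negbTE (sep_neqa s kK)) (negbTE (sep_neqa (sepC hs s) lL)) /=.
  move=> /eqP lq /eqP kq; rewrite kq in kK; rewrite lq in lL.
  by case: (sep_disj s kK lL).
have cross x y : x \in K -> y \in L -> e x y ->
    (x = p /\ y = q) \/ (x = q /\ y = p).
  move=> xK yL exy; have := sep_edge s xK yL; rewrite /ctr /= exy /=.
  have sC := sepC (ctr_sym p t es) s.
  have xy : x != y by apply: contraTneq exy => ->; rewrite (tight_irr tg).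
  have ne w : w != t -> ~~ e t w -> (w == p) || (w == q).
    by move=> wt; rewrite -htx hE eq_sym wt => ->.
  move/negbT; rewrite negb_and !negb_imply => /orP[] /andP[/eqP E].
    move/(ne _ (sep_neqa sC yL)) => /orP[]/eqP E'; last by left.
    by rewrite E E' eqxx in xy.
  rewrite es => /(ne _ (sep_neqa s xK)) => /orP[]/eqP E'; last by right.
  by rewrite E E' eqxx in xy.
case: (boolP [exists x in K, exists y in L, e x y]) => [|nocross].
  case/exists_inP => x xK /exists_inP[y yL exy].
  have s' : sep (cut_edge e p q) K L t z.
    case: (s) => tz K0 L0 LE tK zK _; split=> // x1 y1 x1K y1L.
    apply/negP => /and3P[e1]; case: (cross _ _ x1K y1L e1) => -[-> ->].
      by rewrite !eqxx.
    by move=> _; rewrite !eqxx.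
  case: (cross _ _ xK yL exy) => -[xE yE]; rewrite xE yE in xK yL exy.
    by exists p, q, z, K, L.
  exists p, q, z, L, K; split=> //; last by rewrite es.
  by apply: sepC s'; apply: cut_edge_sym.
case/negP: tC; apply/CG_P; apply: cS; exists K, L, z.
case: (s) => tz K0 L0 LE tK zK _; split=> // x1 y1 x1K y1L.
apply/negP => e1; case/negP: nocross; apply/exists_inP; exists x1 => //.
by apply/exists_inP; exists y1.
Qed.

(** A vertex [t2] of [D] off the cut is [h]-adjacent to almost all of the opposite side [Q], so
    [#|Q| <= 2]. If [Q] is just [q], the [e]-neighbours of [q] are [p] and [z], which puts [q] into
    [S] and [p] into [CG]. *)
Lemma few_deg2 t : #|S| <= 1 -> 2 < #|D| -> t \in D -> t \notin CG ->
  (forall v, critv e v -> exists2 s, s \in S & e s v) ->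
  nb h t \subset S :|: CG.
Proof.
move=> S1 D3 tD tC cS; have [p [q [z [P [Q [nbt s pP qQ epq]]]]]] := deg2_bridge tD tC cS.
have [t2 t2D /andP[t2t t2z]] := card_pick2 t z D3.
have cs w w' : symmetric (cut_edge e w w') by apply: cut_edge_sym.
wlog t2P : p q P Q nbt s pP qQ epq / t2 \in P.
  move=> hyp; case: (sepP t2 s) => [E|E|t2P|t2Q]; try clash.
    exact: (hyp p q P Q).
  apply: (hyp q p Q P) => //; [by rewrite setUC| |by rewrite es].
  case: (sepC (cs p q) s) => tz K0 L0 LE tK zK ed; split=> // x y xQ yP.
  by have := ed _ _ xQ yP; rewrite /cut_edge /= [X in _ && X]andbC.
have sC := sepC (cs p q) s.
have htx x : h t x = (x == p) || (x == q) by rewrite -in_nb nbt !inE.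
have cross x y : x \in P -> y \in Q -> e x y -> x = p /\ y = q.
  move=> xP yQ exy; have := sep_edge s xP yQ; rewrite /cut_edge /= exy /=.
  move/negbT; rewrite negb_and !negbK => /orP[]/andP[/eqP ? /eqP ?] //.
  by subst; case: (sep_disj s pP yQ).
have crossh x y : x \in P -> y \in Q -> x != p \/ y != q -> h x y.
  move=> xP yQ ne; rewrite hE; apply/andP; split.
    by apply: contraTneq yQ => <-; apply/negP => /(sep_disj s xP).
  by apply/negP => /(cross _ _ xP yQ)[E1 E2]; case: ne => /eqP.
have Q2 : #|Q| <= 2.
  case: (eqVneq t2 p) => [t2p|t2p].
    have sub : t |: (Q :\ q) \subset nb h t2.
      apply/subsetP => y; rewrite !inE => /orP[/eqP->|/andP[yq yQ]].
        by rewrite hs htx t2p eqxx.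
      by apply: crossh => //; right.
    have := subset_leq_card sub; rewrite card_deg2_nb // cardsU1 (cardsD1 q Q) qQ.
    by rewrite !inE (negbTE (sep_aK sC)) andbF /=; clear; lia.
  rewrite -(card_deg2_nb t2D); apply: subset_leq_card; apply/subsetP => y yQ.
  by rewrite inE; apply: crossh => //; left.
have neq_tq : ~~ e t q.
  by apply/negP => etq; have := htx q; rewrite eqxx orbT hE etq andbF.
have nbQ x y : x \in Q -> e x y -> [\/ y = t, y = z, y = p /\ x = q | y \in Q].
  move=> xQ exy; case: (sepP y s); try by constructor.
  by rewrite es in exy => yP; have [] := cross _ _ yP xQ exy; constructor.
case: (leqP #|Q| 1) => Q1.
  have QE y : y \in Q -> y = q by move=> yQ; apply: (card_le1_eqP Q1).
  have sub : nb e q \subset [set p; z].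
    apply/subsetP => y; rewrite !inE => eqy; case: (nbQ _ _ qQ eqy).
    - by move=> E; rewrite E es (negbTE neq_tq) in eqy.
    - by move->; rewrite eqxx orbT.
    - by case=> ->; rewrite eqxx.
    - by move/QE => E; rewrite E (tight_irr tg) in eqy.
  have pz : p != z := sep_neqb s pP.
  have qS : q \in S.
    rewrite inE eqn_leq; have := subset_leq_card sub; rewrite cards2 pz => -> /=.
    have T3 : 2 < #|T| by apply: leq_trans T11.
    have [x [xq _ ex]] := biconn_deg2 q q be T3; have [y [yx _ ey]] := biconn_deg2 q x be T3.
    have /subset_leq_card : [set x; y] \subset nb e q.
      by apply/subsetP => w /set2P[]->; rewrite inE.
    by rewrite cards2 eq_sym yx.
  rewrite nbt; apply/subsetP => x /set2P[]->; rewrite in_setU; last by rewrite qS.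
  by apply/orP; right; apply/CG_P; exists q; rewrite // es.
(* If [#|Q| = 2], every vertex of [D] other than [t], [z], [p] has [Q] as its [h]-neighbourhood.
   Then [cover] reaches at most 8 vertices, two each from [CG], [Q], [{p, t}] and the neighbourhood
   of [z]. *)
have {Q1}/eqP/cards2P[q1 [q2 [q12 QE]]] : #|Q| = 2 by apply/eqP; rewrite eqn_leq Q2 Q1.
have QD x : x \in Q -> x \notin D.
  move=> xQ; apply/negP => xD; have := card_nb x; rewrite (card_deg2_nb xD).
  have /subset_leq_card : nb e x \subset [set t; z; p] :|: Q.
    apply/subsetP => y; rewrite !in_setU !in_set1 in_nb => exy.
    by case: (nbQ _ _ xQ exy) => [->|->|[-> _]|->]; rewrite ?eqxx ?orbT.
  have : #|[set t; z; p] :|: Q| <= 5.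
    rewrite cardsU -setUA !cardsU1 cards1; move: Q2; clear.
    by do !case: (_ \notin _); lia.
  by move: T11; clear; lia.
have nbD t3 : t3 \in D -> t3 != t -> t3 != z -> t3 != p -> nb h t3 = Q.
  move=> t3D t3t t3z t3p; case: (sepP t3 s) => [E|E|t3P|/QD nD]; try clash.
  apply/esym/eqP; rewrite eqEcard card_deg2_nb // QE cards2 q12 andbT -QE.
  by apply/subsetP => y yQ; rewrite inE; apply: crossh => //; left.
have [q' q'Q q'q] : exists2 q', q' \in Q & q' != q.
  have /card_gt0P[x] : 0 < #|Q :\ q|.
    by have := cardsD1 q Q; rewrite qQ QE cards2 q12; clear; lia.
  by rewrite !inE => /andP[]; exists x.
have nbp : p \in D -> nb h p = [set t; q'].
  move=> pD; apply/esym/eqP; rewrite eqEcard card_deg2_nb // cards2.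
  rewrite eq_sym (sep_neqa sC q'Q) andbT; apply/subsetP => x /set2P[]->; rewrite inE.
    by rewrite hs htx eqxx.
  by apply: crossh => //; right.
pose Wz := if z \in D then nb h z else set0.
have cov v : v \in CG :|: (Q :|: [set p; t] :|: Wz).
  rewrite !in_setU; case: (cover v) => [/CG_P->//|[t3 t3D ht3]].
  apply/orP; right; rewrite -in_nb in ht3.
  case: (eqVneq t3 t) => [E|t3t].
    by move: ht3; rewrite E nbt => /set2P[]->; rewrite ?qQ ?in_set1 ?eqxx ?orbT.
  case: (eqVneq t3 z) => [E|t3z]; first by rewrite /Wz -E t3D ht3 !orbT.
  case: (eqVneq t3 p) => [E|t3p].
    move: ht3 t3D; rewrite E => H pD; move: H; rewrite nbp // => /set2P[]->.
      by rewrite !inE eqxx !orbT.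
    by rewrite q'Q.
  by rewrite -(nbD t3 t3D) // ht3.
have : #|CG :|: (Q :|: [set p; t] :|: Wz)| = #|T|.
  by rewrite -cardsT; apply: eq_card => v; rewrite cov inE.
have : #|Wz| <= 2.
  by rewrite /Wz; case zD: (z \in D); rewrite ?cards0 // card_deg2_nb.
have : #|[set p; t]| <= 2 by rewrite cards2; case: eqP.
by have := card_CG; rewrite !cardsU; move: T11 S1 Q2; clear; lia.
Qed.

(** By [few_deg2], only vertices of [D] inside [CG] cover anything outside [S :|: CG]. As
    [#|CG| <= 2], this reaches at most 1 + 2 + 4 vertices. *)
Lemma few_bound : #|S| <= 1 ->
  (forall v, critv e v -> exists2 s, s \in S & e s v) -> False.
Proof.
move=> S1 cS; have cC := card_CG.
have covC : CG :|: \bigcup_(t in D) nb h t = setT.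
  apply/setP => v; rewrite !inE; apply/orP.
  case: (cover v) => [/CG_P->|[t tD htv]]; [by left|right].
  by apply/bigcupP; exists t => //; rewrite in_nb.
have D3 : 2 < #|D|.
  have := card_bigcup_leq D (nb h).
  have -> : \sum_(t in D) #|nb h t| = #|D| * 2.
    by rewrite -sum_nat_const; apply: eq_bigr => t; apply: card_deg2_nb.
  by have := cardsT T; rewrite -covC cardsU; lia.
have : [set: T] \subset S :|: CG :|: \bigcup_(t in CG :&: D) nb h t.
  rewrite -covC subUset; apply/andP; split.
    by apply/subsetP => x xC; rewrite !in_setU xC orbT.
  apply/bigcupsP => t tD; case tC: (t \in CG).
    apply/subsetP => x xt; rewrite in_setU; apply/orP; right.
    by apply/bigcupP; exists t; rewrite // in_setI tC.
  by apply: subset_trans (few_deg2 S1 D3 tD (negbT tC) cS) (subsetUl _ _).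
move/subset_leq_card; rewrite cardsT.
have := card_bigcup_leq (CG :&: D) (nb h).
have -> : \sum_(t in CG :&: D) #|nb h t| = #|CG :&: D| * 2.
  by rewrite -sum_nat_const; apply: eq_bigr => t /setIP[_]; apply: card_deg2_nb.
have := subset_leq_card (subsetIl CG D).
rewrite !cardsU; lia.
Qed.

End NarrowCuts.

Lemma tight_bound (T : finType) (e h : rel T) : tight e h -> #|T| <= 10.
Proof.
move=> tg; have tgC := tightC tg; case: (leqP #|T| 10) => // T11.
have thin (e' h' : rel T) : tight e' h' -> forall K L a b, sep e' K L a b -> #|K| <= 1 \/ #|L| <= 1.
  move=> tg' K L a b s; case: (leqP #|K| 1) => K1; first by left.
  case: (leqP #|L| 1) => L1; first by right.
  by have := wide_bound tg' s K1 L1; rewrite leqNgt T11.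
have cG v : critv e v -> exists2 s, s \in deg2 e & e s v.
  exact: (crit_deg2 tg (thin _ _ tg)).
have cH v : critv h v -> exists2 s, s \in deg2 h & h s v.
  exact: (crit_deg2 tgC (thin _ _ tgC)).
have cov v : (exists2 s, s \in deg2 e & e s v) \/ (exists2 t, t \in deg2 h & h t v).
  by case: (tight_crit tg v) => [/cG|/cH]; [left|right].
have covC v : (exists2 s, s \in deg2 h & h s v) \/ (exists2 t, t \in deg2 e & e t v).
  by case: (cov v); [right|left].
case: (leqP 2 #|deg2 e|) => S2; last by case: (few_bound tg T11 cov S2 cG).
case: (leqP 2 #|deg2 h|) => D2; last by case: (few_bound tgC T11 covC D2 cH).
by case: (many_bound tg T11 cov S2 D2).
Qed.

(** * Minimal graphs that are not 2-cographs *)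

Lemma biconn_or (T : finType) (e : rel T) : biconn e \/
  exists (K : {set T}) z, [/\ z \notin K, exists x, x \in K, exists2 w, w \notin K & w != z
    & forall x y, x \in K -> y \notin K -> y != z -> e x y = false].
Proof.
pose bad (K : {set T}) z := [&& z \notin K, [exists x, x \in K],
  [exists w, (w \notin K) && (w != z)]
  & [forall x in K, forall y, (y \notin K) && (y != z) ==> ~~ e x y]].
case: (boolP [exists K, exists z, bad K z]) => [|nobad].
  case/existsP => K /existsP[z /and4P[zK /existsP[x xK] /existsP[w /andP[wK wz]]]].
  move=> /forall_inP edge; right; exists K, z; split=> //; [by exists x|by exists w|].
  move=> x1 y x1K yK yz; apply/negbTE.
  by have /forallP/(_ y) := edge _ x1K; rewrite yK yz.
left=> K z zK [x xK] [w wK wz].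
case: (boolP [exists x in K, exists y, [&& y \notin K, y != z & e x y]]) => [|noe].
  by case/exists_inP => x1 x1K /existsP[y /and3P[]]; exists x1, y.
case/negP: nobad; apply/existsP; exists K; apply/existsP; exists z.
apply/and4P; split=> //; first by apply/existsP; exists x.
  by apply/existsP; exists w; rewrite wK.
apply/forall_inP => x1 x1K; apply/forallP => y; apply/implyP => /andP[yK yz].
apply/negP => exy; case/negP: noe; apply/exists_inP; exists x1 => //.
by apply/existsP; exists y; rewrite yK yz.
Qed.

(** Deletion and contraction live on the subtype without [v]; a failure there, read in [T], is a
    2-cut through [v]. The diagonal is exempt because contraction discards loops that its formula on
    [T] may produce. *)
Lemma sub_biconn_or (T : finType) (c : rel T) v (c' : rel {x : T | x \in [set~ v]}) :
  (forall x y, x != y -> c' x y = c (val x) (val y)) -> biconn c' \/ critv c v.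
Proof.
move=> cE; case: (biconn_or c') => [|[K [z [zK [x xK] [w wK wz] edge]]]]; first by left.
right; pose K0 : {set T} := val @: K.
have inK0 (y : {x : T | x \in [set~ v]}) : (val y \in K0) = (y \in K).
  by rewrite mem_imset //; apply: val_inj.
have vK : v \notin K0.
  by apply/imsetP => -[y _ E]; have := valP y; rewrite -E !inE eqxx.
exists K0, [set y | [&& y \notin K0, y != v & y != val z]], (val z); split=> //.
- by have := valP z; rewrite !inE eq_sym.
- by exists (val x); rewrite inK0.
- by exists (val w); rewrite inE inK0 wK /= (inj_eq val_inj) wz andbT;
    have := valP w; rewrite !inE.
- by move=> y; rewrite inE.
- by rewrite inK0.
move=> _ y /imsetP[x1 x1K ->]; rewrite inE => /and3P[yK yv yz].
have yS : y \in [set~ v] by rewrite !inE.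
have y1K : Sub y yS \notin K by rewrite -inK0.
rewrite -(cE x1 (Sub y yS)); last by apply: contraNneq y1K => <-.
by apply: edge => //; rewrite -(inj_eq val_inj).
Qed.

Lemma biconn_iso (T1 T2 : finType) (e1 : rel T1) (e2 : rel T2) (f : T1 -> T2) :
  bijective f -> (forall x y, e1 x y = e2 (f x) (f y)) -> biconn e2 -> biconn e1.
Proof.
move=> bf eE b2 K z zK [x xK] [w wK wz]; have injf := bij_inj bf.
have inK y : (f y \in f @: K) = (y \in K) by rewrite mem_imset.
have [|||_ [y [/imsetP[x1 x1K ->] yK yz exy]]] := b2 (f @: K) (f z).
- by rewrite inK.
- by exists (f x); rewrite inK.
- by exists (f w); rewrite ?inK // (inj_eq injf).
have [g _ gK] := bf; exists x1, (g y); split=> //.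
- by rewrite -inK gK.
- by rewrite -(inj_eq injf) gK.
- by rewrite eE gK.
Qed.

Lemma ncomp_le1 (G : sgraph) :
  reflect (forall x y : G, connect (@adj G) x y) (ncomp G <= 1).
Proof.
have cs : connect_sym (@adj G) by apply: sym_connect_sym; apply: adj_sym.
apply: (iffP idP) => [/card_le1_eqP c1 x y|cn].
  apply/(rootP cs); apply: c1; by rewrite inE /= roots_root.
apply/card_le1_eqP => x y; rewrite !inE !andbT => /eqP <- /eqP <-.
by apply/(rootP cs).
Qed.

(** [biconn] amounts to connectedness after each single deletion; two vertices of [G] are then
    joined by a path avoiding some third vertex. *)
Lemma two_connectedP (G : sgraph) :
  reflect (2 < #|G| /\ biconn (@adj G)) (two_connected G).
Proof.
apply: (iffP and3P) => [[G3 /andP[_ /forallP conn] /forallP nocut]|[G3 bG]].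
  split=> // K z zK [x xK] [w wK wz].
  case: (boolP [exists x in K, exists y, [&& y \notin K, y != z & adj x y]]) => [|noe].
    by case/exists_inP => x1 x1K /existsP[y /and3P[]]; exists x1, y.
  have le1 : ncomp (del_vertex z) <= 1.
    apply: leq_trans (_ : ncomp G <= 1); first by have := nocut z; rewrite -leqNgt.
    by apply/ncomp_le1 => x1 y1; have /forallP := conn x1.
  have xz : x \in [set~ z] by rewrite !inE; apply: contraTneq xK => ->.
  have wz' : w \in [set~ z] by rewrite !inE.
  have cl : closed (@adj (del_vertex z)) [pred y | val y \in K].
    apply: intro_closed; first by apply: sym_connect_sym; apply: adj_sym.
    move=> x1 y1 /= a1; rewrite !inE => x1K; apply/negPn/negP => y1K.
    case/negP: noe; apply/exists_inP; exists (val x1) => //.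
    apply/existsP; exists (val y1); rewrite y1K (a1 : adj (val x1) (val y1)) andbT.
    by have := valP y1; rewrite !inE.
  have /(closed_connect cl) : connect (@adj (del_vertex z)) (Sub x xz) (Sub w wz').
    by move/ncomp_le1: le1; apply.
  by rewrite !inE /= xK (negbTE wK).
have del (z : G) : forall x y : del_vertex z, connect (@adj (del_vertex z)) x y.
  move=> x y; apply/negPn/negP => nxy.
  pose K : {set G} := val @: [set w : del_vertex z | connect (@adj _) x w].
  have inK (w : del_vertex z) : (val w \in K) = connect (@adj _) x w.
    by rewrite mem_imset ?inE //; apply: val_inj.
  have [||| x1 [y1 [x1K y1K y1z a1]]] := bG K z.
  - by apply/imsetP => -[w _ E]; have := valP w; rewrite -E !inE eqxx.
  - by exists (val x); rewrite inK connect0.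
  - by exists (val y); [rewrite inK|have := valP y; rewrite !inE].
  case/imsetP: x1K a1 => w1; rewrite inE => xw1 -> a1.
  have y1S : y1 \in [set~ z] by rewrite !inE.
  case/negP: y1K; rewrite -[y1]/(val (Sub y1 y1S : del_vertex z)) inK.
  by apply: connect_trans xw1 (connect1 _).
have conn (x y : G) : connect (@adj G) x y.
  have [z /andP[zx zy]] := card_pickT x y G3.
  have xS : x \in [set~ z] by rewrite !inE eq_sym.
  have yS : y \in [set~ z] by rewrite !inE eq_sym.
  have /connectP[p pth E] := del z (Sub x xS) (Sub y yS).
  apply/connectP; exists (map val p).
    by rewrite -[x]/(val (Sub x xS : del_vertex z)) path_map.
  by rewrite -[x]/(val (Sub x xS : del_vertex z)) last_map -E.
split=> //.
  apply/andP; split; first by lia.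
  by apply/forallP => x; apply/forallP => y.
apply/forallP => v; rewrite /cut_vertex -leqNgt.
have /ncomp_le1 d1 := del v; apply: leq_trans d1 _.
have /card_gt0P[x _] : 0 < #|G| by lia.
apply/card_gt0P; exists (root (@adj G) x); rewrite inE /= andbT.
by apply: roots_root; apply: sym_connect_sym; apply: adj_sym.
Qed.

Lemma two_connected_iso (G1 G2 : sgraph) (f : G1 -> G2) :
  bijective f -> (forall x y, adj x y = adj (f x) (f y)) ->
  two_connected G2 -> two_connected G1.
Proof.
move=> bf aE /two_connectedP[G3 b2]; apply/two_connectedP; split.
  by rewrite (bij_eq_card bf).
exact: biconn_iso bf aE b2.
Qed.

Lemma two_connected_compl_iso (G1 G2 : sgraph) (f : G1 -> G2) :
  bijective f -> (forall x y, adj x y = adj (f x) (f y)) ->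
  two_connected (compl G2) -> two_connected (compl G1).
Proof.
move=> bf aE; apply: (@two_connected_iso (compl G1) (compl G2) f bf) => x y.
by rewrite /= /compl_adj /= aE (bij_eq bf).
Qed.

Lemma val_setT_bij (G : sgraph) : bijective (val : induced [set: G] -> G).
Proof.
exists (fun x => Sub x (in_setT x)) => x; last by [].
by apply: val_inj.
Qed.

Lemma two_cograph_not_biconn (G : sgraph) :
  two_cograph G -> two_connected G -> two_connected (compl G) -> False.
Proof.
move=> /existsPn/(_ setT) nb c cc; case/negP: nb.
have bv := val_setT_bij G; have aE (x y : induced [set: G]) : adj x y = adj (val x) (val y) by [].
apply/andP; split; first exact: two_connected_iso bv aE c.
exact: two_connected_compl_iso bv aE cc.
Qed.

(** A set [A] witnessing the failure is the whole vertex set, since otherwise it survives the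
    deletion of a vertex [v] outside it. *)
Lemma minimal_two_connected (G : sgraph) : ~~ two_cograph G ->
  (forall v : G, two_cograph (del_vertex v)) ->
  two_connected G /\ two_connected (compl G).
Proof.
rewrite negbK => /existsP[A /andP[cA ccA]] hd.
case: (pickP [pred v | v \notin A]) => [v /= vA|allA].
  pose A' : {set del_vertex v} := [set x | val x \in A].
  have sv x : x \in A -> x \in [set~ v].
    by move=> xA; rewrite !inE; apply: contraTneq xA => ->.
  have memA (x : induced A') : val (val x) \in A by have := valP x; rewrite inE.
  have memA' (x : induced A) : (Sub (val x) (sv _ (valP x)) : del_vertex v) \in A'.
    by rewrite inE; exact: valP x.
  pose f (x : induced A') : induced A := Sub (val (val x)) (memA x).
  have bf : bijective f.
    pose g (x : induced A) : induced A' := exist (fun y => y \in A') _ (memA' x).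
    exists g => x; last by apply: val_inj.
    by apply: val_inj; apply: val_inj.
  have aE (x y : induced A') : adj x y = adj (f x) (f y) by [].
  case/negP: (hd v); apply/existsP; exists A'; apply/andP; split.
    exact: two_connected_iso bf aE cA.
  exact: two_connected_compl_iso bf aE ccA.
have AT : A = setT by apply/setP => x; have := allA x; rewrite /= !inE => /negbFE.
rewrite AT in cA ccA; have [g gK Kg] := val_setT_bij G.
have bg : bijective g by exists val.
have aE (x y : G) : adj x y = adj (g x) (g y) by rewrite /= /induced_adj /= !Kg.
split; first exact: two_connected_iso bg aE cA.
exact: two_connected_compl_iso bg aE ccA.
Qed.

Lemma card_setC1_sig (T : finType) (v : T) : #|{: {x : T | x \in [set~ v]}}| = #|T|.-1.
Proof. by rewrite card_sig -(cardsC1 v); apply: eq_card => x; rewrite !inE. Qed.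

Section Minimal.
Variables (G : sgraph) (h : rel G).
Hypothesis hE : forall x y, h x y = (x != y) && ~~ adj x y.
Hypothesis G4 : 3 < #|G|.
Hypothesis bG : biconn (@adj G).
Hypothesis hstep : forall H, minor_step G H -> two_cograph H.

Lemma minimal_crit v : critv (@adj G) v \/ critv h v.
Proof.
have c3 : 2 < #|{: {x : G | x \in [set~ v]}}| by rewrite card_setC1_sig; lia.
have [b1|] := @sub_biconn_or G (@adj G) v (@adj (del_vertex v)) (fun x y _ => erefl).
  have [|b2|] := @sub_biconn_or G h v (@adj (compl (del_vertex v))); last by right.
    by move=> x y xy; rewrite hE (inj_eq val_inj) xy /= /compl_adj /= xy.
  case: (two_cograph_not_biconn (hstep (StepDelete v))).
    by apply/two_connectedP.
  by apply/two_connectedP.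
by left.
Qed.

Lemma minimal_ctr a b : adj a b ->
  (exists K L, sep (@adj G) K L a b) \/ critv (ctr h a b) b.
Proof.
move=> eab.
have es := @adj_sym G.
have c3 : 2 < #|{: {x : G | x \in [set~ b]}}| by rewrite card_setC1_sig; lia.
pose c : rel G := [rel x y | [|| adj x y, (x == a) && adj b y | (y == a) && adj x b]].
have [|b1|] := @sub_biconn_or G c b (@adj (contract a b)).
- by move=> x y xy; rewrite /= /contract_adj /= xy.
- have [|b2|] := @sub_biconn_or G (ctr h a b) b (@adj (compl (contract a b))); last by right.
    move=> x y xy; have vxy : val x != val y by rewrite (inj_eq val_inj).
    have xb : val x != b by have := valP x; rewrite !inE.
    have yb : b != val y by have := valP y; rewrite !inE eq_sym.
    rewrite /ctr /= !hE vxy xb yb /= /compl_adj /= /contract_adj /= xy /=.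
    by rewrite !negb_or !negb_and !implybE.
  case: (two_cograph_not_biconn (hstep (StepContract eab))).
    by apply/two_connectedP.
  by apply/two_connectedP.
case=> K [L [z s]]; left.
have cs : symmetric c.
  by move=> x y; rewrite /c /= es (es b) (es x b); congr (_ || _); rewrite orbC.
have ce x y : adj x y -> c x y by rewrite /c /= => ->.
(* The cut vertex [z] of the contraction [c] must be the merged vertex [a]; otherwise [z] would
   already cut off the side without [a] in [G]. *)
case: (eqVneq a z) => [az|az].
  exists K, L; apply: sep_swap; rewrite az.
  case: s => bz K0 L0 LE bK zK ed; split=> // x y xK yL.
  by apply/negP => /ce; rewrite ed.
wlog aK : K L s / a \in K.
  move=> hyp; case: (sepP a s) => [E|E|aK|aL].
  - by rewrite E adj_irr in eab.
  - by rewrite E eqxx in az.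
  - exact: hyp s aK.
  - exact: hyp (sepC cs s) aL.
case: (@biconn_closed _ (@adj G) L z bG).
- exact: sep_bK (sepC cs s).
- exact: sep_r s.
- by exists a => //; apply/negP => /(sep_disj s aK).
move=> x y xL exy yz.
case: (sep_nb (sepC cs s) xL (ce _ _ exy)) => // E; last by rewrite E eqxx in yz.
have := sep_edge s aK xL; rewrite /c /= eqxx /= es.
by rewrite -E [adj y x]es exy orbT.
Qed.
End Minimal.

(** The degrees of a vertex in [e] and in [h] are both at least 2 and add up to [#|T| - 1]. *)
Lemma biconn_card5 (T : finType) (e h : rel T) : irreflexive e ->
  (forall x y, h x y = (x != y) && ~~ e x y) ->
  biconn e -> biconn h -> 2 < #|T| -> 4 < #|T|.
Proof.
move=> ei hE be bh T3; have /card_gt0P[x _] : 0 < #|T| by lia.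
have nb2 c : biconn c -> 1 < #|nb c x|.
  move=> bc; have [y [_ _ cy]] := biconn_deg2 x x bc T3.
  have [z [zy _ cz]] := biconn_deg2 x y bc T3.
  have /subset_leq_card : [set y; z] \subset nb c x.
    by apply/subsetP => w /set2P[]->; rewrite in_nb.
  by rewrite cards2 eq_sym zy.
have := card_nb_cpl ei hE x; have := nb2 _ be; have := nb2 _ bh; lia.
Qed.

Theorem theorem1p2 (G : sgraph)
  (hG : ~~ two_cograph G)
  (hminor : forall H : sgraph, proper_induced_minor G H -> two_cograph H)
  (hcominor : forall H : sgraph,
     proper_induced_minor (compl G) H -> two_cograph H) :
  5 <= #|G| <= 10.
Proof.
have hs H : minor_step G H -> two_cograph H by move=> st; apply: hminor; apply: t_step.
have hcs H : minor_step (compl G) H -> two_cograph H.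
  by move=> st; apply: hcominor; apply: t_step.
have [/two_connectedP[G3 bG] /two_connectedP[_ bH]] :=
  minimal_two_connected hG (fun v => hs _ (StepDelete v)).
have hE x y : adj (x : compl G) y = (x != y) && ~~ adj (x : G) y by [].
(* The double complement is not literally [G]; this exhibits [G] as the complement of [compl G], so
   that [minimal_ctr] also applies to [compl G]. *)
have eE x y : adj (x : G) y = (x != y) && ~~ adj (x : compl G) y.
  by rewrite hE negb_and !negbK; case: eqP => [->|]; rewrite ?adj_irr.
have G5 := biconn_card5 (@adj_irr G) hE bG bH G3.
have G4 : 3 < #|G| by apply: ltnW.
rewrite G5; apply: (@tight_bound G (@adj G) (@adj (compl G))); split=> //.
- exact: adj_sym.
- exact: adj_irr.
- exact: (@minimal_crit G _ hE G4 hs).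
- exact: (@minimal_ctr G _ hE G4 bG hs).
- exact: (@minimal_ctr (compl G) _ eE G4 bH hcs).
Qed.
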